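(* Fix an integer $m\geq 1$. For real parameters $p_-,q_-,p_+,q_+$ with $-1<p_\pm\leq q_\pm<1$, let $\xi^{(m)}_{\hat l}$ and $\Psi^{(m)}_{\hat l,l}$ ($\hat l,l\in\{0,1,\ldots,m\}$) be the spectral points and Fourier kernel defined in the context. When the parameters tend (within the domain $-1<p_\pm\leq q_\pm<1$) to the values indicated below, then for all $\hat l,l\in\{0,1,\ldots,m\}$ the following limits hold. (DCT-1) $(p_\pm,q_\pm)\to(-1,1)$: $\xi^{(m)}_{\hat l}\to\frac{\pi\hat l}{m}$ and $\Psi^{(m)}_{\hat l,l}\to\sqrt{\frac{2}{m}}\cos\bigl(\frac{\pi\hat l l}{m}\bigr)\bigl(\frac{1}{\sqrt2}\bigr)^{\delta_{\hat l}+\delta_{m-\hat l}+\delta_l+\delta_{m-l}}$. (DCT-2) $(p_\pm,q_\pm)\to(0,1)$: $\xi^{(m)}_{\hat l}\to\frac{\pi\hat l}{m+1}$ and $\Psi^{(m)}_{\hat l,l}\to\sqrt{\frac{2}{m+1}}\cos\bigl(\frac{\pi\hat l(l+\frac12)}{m+1}\bigr)\bigl(\frac{1}{\sqrt2}\bigr)^{\delta_{\hat l}}$. (DCT-3) $(p_-,q_-)\to(-1,1)$, $(p_+,q_+)\to(0,0)$: $\xi^{(m)}_{\hat l}\to\frac{\pi(\hat l+\frac12)}{m+1}$ and $\Psi^{(m)}_{\hat l,l}\to\sqrt{\frac{2}{m+1}}\cos\bigl(\frac{\pi(\hat l+\frac12)l}{m+1}\bigr)\bigl(\frac{1}{\sqrt2}\bigr)^{\delta_l}$.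 (DCT-4) $(p_-,q_-)\to(0,1)$, $(p_+,q_+)\to(-1,0)$: $\xi^{(m)}_{\hat l}\to\frac{\pi(\hat l+\frac12)}{m+1}$ and $\Psi^{(m)}_{\hat l,l}\to\sqrt{\frac{2}{m+1}}\cos\bigl(\frac{\pi(\hat l+\frac12)(l+\frac12)}{m+1}\bigr)$. (DCT-5) $(p_-,q_-)\to(-1,1)$, $(p_+,q_+)\to(0,1)$: $\xi^{(m)}_{\hat l}\to\frac{\pi\hat l}{m+\frac12}$ and $\Psi^{(m)}_{\hat l,l}\to\sqrt{\frac{2}{m+\frac12}}\cos\bigl(\frac{\pi l\hat l}{m+\frac12}\bigr)\bigl(\frac{1}{\sqrt2}\bigr)^{\delta_l+\delta_{\hat l}}$. (DCT-6) $(p_-,q_-)\to(0,1)$, $(p_+,q_+)\to(-1,1)$: $\xi^{(m)}_{\hat l}\to\frac{\pi\hat l}{m+\frac12}$ and $\Psi^{(m)}_{\hat l,l}\to\sqrt{\frac{2}{m+\frac12}}\cos\bigl(\frac{\pi\hat l(l+\frac12)}{m+\frac12}\bigr)\bigl(\frac{1}{\sqrt2}\bigr)^{\delta_{\hat l}+\delta_{m-l}}$. (DCT-7) $(p_-,q_-)\to(-1,1)$, $(p_+,q_+)\to(-1,0)$: $\xi^{(m)}_{\hat l}\to\frac{\pi(\hat l+\frac12)}{m+\frac12}$ and $\Psi^{(m)}_{\hat l,l}\to\sqrt{\frac{2}{m+\frac12}}\cos\bigl(\frac{\pi(\hat l+\frac12)l}{m+\frac12}\bigr)\bigl(\frac{1}{\sqrt2}\bigr)^{\delta_{m-\hat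 l}+\delta_l}$. (DCT-8) $(p_-,q_-)\to(0,1)$, $(p_+,q_+)\to(0,0)$: $\xi^{(m)}_{\hat l}\to\frac{\pi(\hat l+\frac12)}{m+\frac32}$ and $\Psi^{(m)}_{\hat l,l}\to\sqrt{\frac{2}{m+\frac32}}\cos\bigl(\frac{\pi(\hat l+\frac12)(l+\frac12)}{m+\frac32}\bigr)$. (DST-1) $(p_\pm,q_\pm)\to(0,0)$: $\xi^{(m)}_{\hat l}\to\frac{\pi(\hat l+1)}{m+2}$ and $\Psi^{(m)}_{\hat l,l}\to\sqrt{\frac{2}{m+2}}\sin\bigl(\frac{\pi(\hat l+1)(l+1)}{m+2}\bigr)$. (DST-2) $(p_\pm,q_\pm)\to(-1,0)$: $\xi^{(m)}_{\hat l}\to\frac{\pi(\hat l+1)}{m+1}$ and $\Psi^{(m)}_{\hat l,l}\to\sqrt{\frac{2}{m+1}}\sin\bigl(\frac{\pi(\hat l+1)(l+\frac12)}{m+1}\bigr)\bigl(\frac{1}{\sqrt2}\bigr)^{\delta_{m-\hat l}}$. (DST-3) $(p_-,q_-)\to(0,0)$, $(p_+,q_+)\to(-1,1)$: $\xi^{(m)}_{\hat l}\to\frac{\pi(\hat l+\frac12)}{m+1}$ and $\Psi^{(m)}_{\hat l,l}\to\sqrt{\frac{2}{m+1}}\sin\bigl(\frac{\pi(\hat l+\frac12)(l+1)}{m+1}\bigr)\bigl(\frac{1}{\sqrt2}\bigr)^{\delta_{m-l}}$. (DST-4) $(p_-,q_-)\to(-1,0)$, $(p_+,q_+)\to(0,1)$: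 $\xi^{(m)}_{\hat l}\to\frac{\pi(\hat l+\frac12)}{m+1}$ and $\Psi^{(m)}_{\hat l,l}\to\sqrt{\frac{2}{m+1}}\sin\bigl(\frac{\pi(\hat l+\frac12)(l+\frac12)}{m+1}\bigr)$. (DST-5) $(p_-,q_-)\to(0,0)$, $(p_+,q_+)\to(-1,0)$: $\xi^{(m)}_{\hat l}\to\frac{\pi(\hat l+1)}{m+\frac32}$ and $\Psi^{(m)}_{\hat l,l}\to\sqrt{\frac{2}{m+\frac32}}\sin\bigl(\frac{\pi(\hat l+1)(l+1)}{m+\frac32}\bigr)$. (DST-6) $(p_-,q_-)\to(-1,0)$, $(p_+,q_+)\to(0,0)$: $\xi^{(m)}_{\hat l}\to\frac{\pi(\hat l+1)}{m+\frac32}$ and $\Psi^{(m)}_{\hat l,l}\to\sqrt{\frac{2}{m+\frac32}}\sin\bigl(\frac{\pi(\hat l+1)(l+\frac12)}{m+\frac32}\bigr)$. (DST-7) $(p_-,q_-)\to(0,0)$, $(p_+,q_+)\to(0,1)$: $\xi^{(m)}_{\hat l}\to\frac{\pi(\hat l+\frac12)}{m+\frac32}$ and $\Psi^{(m)}_{\hat l,l}\to\sqrt{\frac{2}{m+\frac32}}\sin\bigl(\frac{\pi(\hat l+\frac12)(l+1)}{m+\frac32}\bigr)$. (DST-8) $(p_-,q_-)\to(-1,0)$, $(p_+,q_+)\to(-1,1)$: $\xi^{(m)}_{\hat l}\to\frac{\pi(\hat l+\frac12)}{m+\frac12}$ and $\Psi^{(m)}_{\hat l,l}\to\sqrt{\frac{2}{m+\frac12}}\sin\bigl(\frac{\pi(\hat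 l+\frac12)(l+\frac12)}{m+\frac12}\bigr)\bigl(\frac{1}{\sqrt2}\bigr)^{\delta_{m-\hat l}+\delta_{m-l}}$.
   Context: Notation. $\delta_l:=1$ if $l=0$ and $\delta_l:=0$ for every nonzero integer $l$. Put $a_\pm:=p_\pm q_\pm$ and $b_\pm:=p_\pm+q_\pm$. A condition written with subscript $\pm$, such as $(p_\pm,q_\pm)\to(-1,1)$, means that both $(p_-,q_-)$ and $(p_+,q_+)$ tend to the indicated pair. For $-1<q<1$ and $\xi\in\mathbb{R}$, $$v_q(\xi):=\int_0^\xi\frac{1-q^2}{1-2q\cos(x)+q^2}\,dx .$$ For $\hat l\in\{0,\ldots,m\}$, $\xi^{(m)}_{\hat l}$ denotes the unique real solution $\xi$ of $$2m\xi+v_{p_-}(\xi)+v_{q_-}(\xi)+v_{p_+}(\xi)+v_{q_+}(\xi)=2\pi(\hat l+1);$$ one has $0<\xi^{(m)}_0<\cdots<\xi^{(m)}_m<\pi$. The function $c$ and the polynomials $p_l(\xi)$ (not to be confused with the parameters $p_\pm$) are $$c(\xi):=\frac{(1-p_-e^{-i\xi})(1-q_-e^{-i\xi})}{1-e^{-2i\xi}},\qquad p_l(\xi):=c(\xi)e^{il\xi}+c(-\xi)e^{-il\xi}\quad(l\in\mathbb{Z}).$$ The weights are $$\Delta^{(m)}_l:=(1-a_-\delta_l)^{-1}(1-a_+\delta_{m-l})^{-1},\qquad \hat\Delta^{(m)}_{\hat l}:=\frac{1}{c(\xi^{(m)}_{\hat l})\,c(-\xi^{(m)}_{\hat l})\,H^{(m)}(\xi^{(m)}_{\hat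 l})},$$ with $H^{(m)}(\xi):=2m+v'_{p_-}(\xi)+v'_{q_-}(\xi)+v'_{p_+}(\xi)+v'_{q_+}(\xi)$ (prime denoting the derivative). The Fourier kernel is $$\Psi^{(m)}_{\hat l,l}:=\sqrt{\hat\Delta^{(m)}_{\hat l}\,\Delta^{(m)}_l}\;p_l(\xi^{(m)}_{\hat l})\qquad(\hat l,l\in\{0,\ldots,m\}).$$ *)

(* Defs.v *)
(* Standard-library reals with Coquelicot. *)
From Stdlib Require Export Reals ZArith Lra.
From Coquelicot Require Export Coquelicot.
Open Scope R_scope.

Definition kron (l : Z) : nat := if Z.eqb l 0 then 1%nat else 0%nat.

(* A parameter point is ((p_-, q_-), (p_+, q_+)). *)
Definition params : Type := ((R * R) * (R * R))%type.
Definition p_minus (P : params) : R := fst (fst P).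
Definition q_minus (P : params) : R := snd (fst P).
Definition p_plus (P : params) : R := fst (snd P).
Definition q_plus (P : params) : R := snd (snd P).

Definition admissible (P : params) : Prop :=
  (-1 < p_minus P /\ p_minus P <= q_minus P /\ q_minus P < 1) /\
  (-1 < p_plus P /\ p_plus P <= q_plus P /\ q_plus P < 1).

Definition a_minus (P : params) : R := p_minus P * q_minus P.
Definition a_plus (P : params) : R := p_plus P * q_plus P.

Definition v (q xi : R) : R :=
  RInt (fun x => (1 - q ^ 2) / (1 - 2 * q * cos x + q ^ 2)) 0 xi.

Definition spectral_equation (m : Z) (P : params) (hl : Z) (xi : R) : Prop :=
  2 * IZR m * xi + v (p_minus P) xi + v (q_minus P) xi
    + v (p_plus P) xi + v (q_plus P) xi = 2 * PI * (IZR hl + 1).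

(* [iota] selects the unique real number satisfying the given predicate; its
   value is unspecified when there is no such unique number. *)
Definition spectral_point (m : Z) (P : params) (hl : Z) : R :=
  iota (spectral_equation m P hl).

(* exp (i x) for real x *)
Definition cis (x : R) : C := (cos x, sin x).

Definition c (P : params) (xi : R) : C :=
  ((1 - p_minus P * cis (- xi)) * (1 - q_minus P * cis (- xi))
     / (1 - cis (- (2 * xi))))%C.

Definition poly (P : params) (l : Z) (xi : R) : C :=
  (c P xi * cis (IZR l * xi) + c P (- xi) * cis (- (IZR l * xi)))%C.

Definition H (m : Z) (P : params) (xi : R) : R :=
  2 * IZR m + Derive (v (p_minus P)) xi + Derive (v (q_minus P)) xi
    + Derive (v (p_plus P)) xi + Derive (v (q_plus P)) xi.

Definition Delta (m : Z) (P : params) (l : Z) : R :=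
  / (1 - a_minus P * INR (kron l)) * / (1 - a_plus P * INR (kron (m - l))).

Definition hat_Delta (m : Z) (P : params) (hl : Z) : C :=
  let xi := spectral_point m P hl in
  (1 / (c P xi * c P (- xi) * H m P xi))%C.

(* [hat_Delta] is real (see [hat_Delta_real]), so that taking [Re] only
   changes its type. *)
Definition Psi (m : Z) (P : params) (hl l : Z) : C :=
  (sqrt (Re (hat_Delta m P hl) * Delta m P l)
     * poly P l (spectral_point m P hl))%C.

(* [x0] and [y0] are the limits of the spectral point and of the kernel as
   ((p_-, q_-), (p_+, q_+)) tends to [P0] inside the parameter domain. *)
Definition limits_at (m hl l : Z) (P0 : params) (x0 y0 : R) : Prop :=
  filterlim (fun P => spectral_point m P hl)
    (within admissible (locally P0)) (locally x0) /\
  filterlim (fun P => Psi m P hl l)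
    (within admissible (locally P0)) (locally (RtoC y0)).

Lemma c_opp (P : params) (xi : R) : c P (- xi) = Cconj (c P xi).
Proof.
unfold c, cis, Cdiv, Cinv, Cconj, Cmult, Cminus, Cplus, Copp, RtoC; simpl.
replace (2 * - xi) with (- (2 * xi)) by ring.
rewrite !Ropp_involutive, !cos_neg, !sin_neg.
apply injective_projections; simpl; unfold Rdiv;
  replace ((1 + - cos (2 * xi)) * ((1 + - cos (2 * xi)) * 1)
     + (0 + - - sin (2 * xi)) * ((0 + - - sin (2 * xi)) * 1))
  with ((1 + - cos (2 * xi)) * ((1 + - cos (2 * xi)) * 1)
     + (0 + - sin (2 * xi)) * ((0 + - sin (2 * xi)) * 1)) by ring;
  ring.
Qed.

Lemma hat_Delta_real (m : Z) (P : params) (hl : Z) :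
  Im (hat_Delta m P hl) = 0.
Proof.
unfold hat_Delta; cbv zeta; rewrite c_opp.
destruct (c P (spectral_point m P hl)) as [x y].
unfold Cdiv, Cinv, Cconj, Cmult, Im, RtoC; simpl; unfold Rdiv; ring.
Qed.

Lemma poly_real (P : params) (l : Z) (xi : R) : Im (poly P l xi) = 0.
Proof.
unfold poly; rewrite c_opp; destruct (c P xi) as [x y].
unfold cis, Cconj, Cmult, Cplus, Im; simpl.
rewrite cos_neg, sin_neg; ring.
Qed.

(* Main.v *)
Require Import Defs.
From Stdlib Require Import Lia.
Open Scope R_scope.

(** Each of the sixteen limits has [p] in {-1,0} and [q] in {0,1} for both
    parameter pairs.  With [D q x = 1 - 2 q cos x + q^2], the kernel at
    [x = xi] is
      [sqrt (Delta_l / H x) * 2 N_l x / sqrt (D p_- x * D q_- x)],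
      [N_l x = sin ((l+1) x) - (p_- + q_-) sin (l x) + p_- q_- sin ((l-1) x)],
    and [v q x = x + 2 atan (q sin x / (1 - q cos x))] extends continuously to
    [q = -1, 0, 1] on (0, pi).  Monotonicity of the spectral equation gives the
    limit of [xi], and if that limit lies in (0, pi) the kernel passes to the
    limit by continuity.  If [xi] tends to 0, which needs both [q] to tend to 1,
    the identities [(v q)' x = sin (v q x) / sin x] and
    [D q x (1 - cos (v q x)) = (1 + q)^2 (1 - cos x)] show that [H] tends to
    twice its naive limit, whence the extra factor [1 / sqrt 2].  The limit pi is
    reduced to 0 by the symmetry [x -> pi - x, (p, q) -> (-q, -p)]. *)

(** * Closed form of the phase function [v] and its trigonometric identities *)

Definition D (q x : R) : R := 1 - 2 * q * cos x + q ^ 2.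
(** This is [x] plus twice the argument of [1 - q exp (- i x)]. The real part of that number stays
    positive for [|q| < 1], so one branch of [atan] serves for all [x]. *)
Definition v_closed (q x : R) : R := x + 2 * atan (q * sin x / (1 - q * cos x)).

Lemma cos2_sin2 (x : R) : cos x ^ 2 + sin x ^ 2 = 1.
Proof. rewrite Rplus_comm, <- !Rsqr_pow2; apply sin2_cos2. Qed.

Lemma D_eq (q x : R) : D q x = (1 - q * cos x) ^ 2 + (q * sin x) ^ 2.
Proof.
unfold D; replace (q ^ 2) with (q ^ 2 * (cos x ^ 2 + sin x ^ 2)) by (rewrite cos2_sin2; ring).
ring.
Qed.

Lemma one_minus_qcos_pos (q x : R) : -1 < q < 1 -> 0 < 1 - q * cos x.
Proof.
intros Hq; destruct (COS_bound x); destruct (Rle_dec 0 q); nra.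
Qed.

Lemma one_minus_qcos_pos_interior (q x : R) :
  -1 <= q <= 1 -> 0 < x < PI -> 0 < 1 - q * cos x.
Proof.
intros Hq Hx.
assert (Hc : -1 < cos x < 1).
{ rewrite <- cos_PI, <- cos_0; split; apply cos_decreasing_1; lra. }
destruct (Rle_dec 0 q); nra.
Qed.

Lemma D_pos_of (q x : R) : 0 < 1 - q * cos x -> 0 < D q x.
Proof. intros Hq; rewrite D_eq; nra. Qed.

Lemma D_pos (q x : R) : -1 < q < 1 -> 0 < D q x.
Proof. intros Hq; apply D_pos_of, one_minus_qcos_pos, Hq. Qed.

Lemma is_derive_v_closed (q x : R) : -1 < q < 1 ->
  is_derive (v_closed q) x ((1 - q ^ 2) / D q x).
Proof.
intros Hq; pose proof (one_minus_qcos_pos q x Hq) as Hp.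
pose proof (D_pos q x Hq) as HD.
unfold v_closed; auto_derive; [lra |].
rewrite D_eq in HD |- *.
field_simplify_eq; [| split; nra].
assert (E : sin x ^ 2 = 1 - cos x ^ 2) by (pose proof (cos2_sin2 x); lra).
ring [E].
Qed.

Lemma v_eq (q x : R) : -1 < q < 1 -> v q x = v_closed q x.
Proof.
intros Hq; unfold v; apply is_RInt_unique.
replace (v_closed q x) with (minus (v_closed q x) (v_closed q 0)).
2:{ unfold minus, plus, opp; simpl; unfold v_closed at 2.
    rewrite sin_0; replace (q * 0 / _) with 0 by (unfold Rdiv; ring).
    rewrite atan_0; ring. }
apply (is_RInt_derive (v_closed q)); intros y _.
- apply is_derive_v_closed, Hq.
- apply (ex_derive_continuous (fun x0 : R => (1 - q ^ 2) / (1 - 2 * q * cos x0 + q ^ 2))).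
  pose proof (D_pos q y Hq) as HD; unfold D in HD.
  auto_derive; lra.
Qed.

Lemma Derive_v (q x : R) : -1 < q < 1 -> Derive (v q) x = (1 - q ^ 2) / D q x.
Proof.
intros Hq; rewrite (Derive_ext _ _ _ (fun t => v_eq q t Hq)).
apply is_derive_unique, is_derive_v_closed, Hq.
Qed.

Lemma v_0 (q : R) : v q 0 = 0.
Proof. unfold v; rewrite RInt_point; reflexivity. Qed.

Lemma v_PI (q : R) : -1 < q < 1 -> v q PI = PI.
Proof.
intros Hq; rewrite v_eq by exact Hq; unfold v_closed; rewrite sin_PI.
replace (q * 0 / _) with 0 by (unfold Rdiv; ring); rewrite atan_0; ring.
Qed.

Lemma v_increasing (q x y : R) : -1 < q < 1 -> x < y -> v q x < v q y.
Proof.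
intros Hq Hxy; rewrite !v_eq by exact Hq.
destruct (MVT_gen (v_closed q) x y (fun t => (1 - q ^ 2) / D q t)) as [t [_ Ht]].
- intros; apply is_derive_v_closed, Hq.
- intros t _; apply continuity_pt_filterlim, (ex_derive_continuous (v_closed q)).
  eexists; apply is_derive_v_closed, Hq.
- assert (0 < (1 - q ^ 2) / D q t) by (apply Rdiv_lt_0_compat; [nra | apply D_pos, Hq]).
  nra.
Qed.

Lemma v_reflect (q x : R) : -1 < q < 1 -> v (- q) (PI - x) = PI - v q x.
Proof.
intros Hq; rewrite !v_eq by lra; unfold v_closed.
rewrite sin_PI_x, Rtrigo_facts.cos_pi_minus.
replace (- q * sin x / (1 - - q * - cos x)) with (- (q * sin x / (1 - q * cos x)))
  by (unfold Rdiv; rewrite Ropp_mult_distr_l; f_equal; [ring | f_equal; ring]).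
rewrite atan_opp; ring.
Qed.

(** Real and imaginary part of [D exp (i v) = exp (i x) (1 - q exp (- i x))^2], since [v - x] is
    twice the argument of [1 - q exp (- i x)], whose squared modulus is [D]. *)
Lemma cos_sin_v (q x : R) : -1 < q < 1 ->
  D q x * cos (v q x) = (1 + q ^ 2) * cos x - 2 * q /\
  D q x * sin (v q x) = (1 - q ^ 2) * sin x.
Proof.
intros Hq; rewrite v_eq by exact Hq; unfold v_closed.
pose proof (one_minus_qcos_pos q x Hq) as Hp.
pose proof (D_pos q x Hq) as HD.
assert (E : sin x ^ 2 = 1 - cos x ^ 2) by (pose proof (cos2_sin2 x); lra).
set (t := q * sin x / (1 - q * cos x)).
assert (Ht : 1 + t ^ 2 = D q x / (1 - q * cos x) ^ 2).
{ unfold t; rewrite D_eq; field; lra. }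
(* The double angle formulas involve [cos (atan t)] only through its square, so the square root in
   [cos_atan] disappears. *)
assert (Hc : cos (atan t) ^ 2 = (1 - q * cos x) ^ 2 / D q x).
{ rewrite cos_atan.
  replace ((1 / sqrt (1 + t²)) ^ 2) with (/ (sqrt (1 + t²) ^ 2))
    by (field; apply Rgt_not_eq, sqrt_lt_R0; unfold Rsqr; nra).
  rewrite pow2_sqrt by (unfold Rsqr; nra).
  rewrite Rsqr_pow2, Ht; field; lra. }
assert (Hs : sin (atan t) = t * cos (atan t)).
{ rewrite sin_atan, cos_atan; unfold Rdiv; ring. }
assert (C2 : D q x * cos (2 * atan t) = (1 - q * cos x) ^ 2 - (q * sin x) ^ 2).
{ rewrite cos_2a, Hs.
  replace (D q x * _) with (D q x * ((1 - t ^ 2) * cos (atan t) ^ 2)) by ring.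
  rewrite Hc; unfold t; field; lra. }
assert (S2 : D q x * sin (2 * atan t) = 2 * (1 - q * cos x) * (q * sin x)).
{ rewrite sin_2a, Hs.
  replace (D q x * _) with (D q x * (2 * t * cos (atan t) ^ 2)) by ring.
  rewrite Hc; unfold t; field; lra. }
rewrite cos_plus, sin_plus; split.
- replace (D q x * _) with (cos x * (D q x * cos (2 * atan t)) - sin x * (D q x * sin (2 * atan t))) by ring.
  rewrite C2, S2.
  ring [E].
- replace (D q x * _) with (sin x * (D q x * cos (2 * atan t)) + cos x * (D q x * sin (2 * atan t))) by ring.
  rewrite C2, S2.
  ring [E].
Qed.

(** * Existence, uniqueness and localization of the spectral points *)

Definition spectral_fun (m : Z) (P : params) (x : R) : R :=
  2 * IZR m * x + v (p_minus P) x + v (q_minus P) x + v (p_plus P) x + v (q_plus P) x.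

Lemma spectral_fun_increasing (m : Z) (P : params) (x y : R) :
  (1 <= m)%Z -> admissible P -> x < y -> spectral_fun m P x < spectral_fun m P y.
Proof.
intros Hm [HP HP'] Hxy; unfold spectral_fun.
apply IZR_le in Hm.
pose proof (v_increasing (p_minus P) x y).
pose proof (v_increasing (q_minus P) x y).
pose proof (v_increasing (p_plus P) x y).
pose proof (v_increasing (q_plus P) x y).
assert (IZR m * x < IZR m * y) by (apply Rmult_lt_compat_l; lra).
lra.
Qed.

Lemma continuity_v (q : R) : -1 < q < 1 -> continuity (v q).
Proof.
intros Hq x; apply continuity_pt_filterlim.
apply (ex_derive_continuous (v q)).
apply (ex_derive_ext (v_closed q)); [intros; symmetry; apply v_eq, Hq |].
eexists; apply is_derive_v_closed, Hq.
Qed.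

Lemma continuity_spectral_fun (m : Z) (P : params) :
  admissible P -> continuity (spectral_fun m P).
Proof.
intros [HP HP'] x; unfold spectral_fun.
repeat apply continuity_pt_plus; try (apply continuity_v; lra).
apply continuity_pt_filterlim, (ex_derive_continuous (fun x => 2 * IZR m * x)).
auto_derive; trivial.
Qed.

Lemma spectral_fun_0 (m : Z) (P : params) : spectral_fun m P 0 = 0.
Proof. unfold spectral_fun; rewrite !v_0; ring. Qed.

Lemma spectral_fun_PI (m : Z) (P : params) :
  admissible P -> spectral_fun m P PI = 2 * PI * (IZR m + 2).
Proof. intros [HP HP']; unfold spectral_fun; rewrite !v_PI by lra; ring. Qed.

Lemma spectral_eq_unique (m : Z) (P : params) (hl : Z) (x y : R) :
  (1 <= m)%Z -> admissible P ->
  spectral_equation m P hl x -> spectral_equation m P hl y -> x = y.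
Proof.
intros Hm HP Hx Hy.
assert (E : spectral_fun m P x = spectral_fun m P y) by (transitivity (2 * PI * (IZR hl + 1)); [exact Hx | symmetry; exact Hy]).
destruct (Rtotal_order x y) as [L | [L | L]]; [| exact L |];
  apply (spectral_fun_increasing m P _ _ Hm HP) in L; lra.
Qed.

(** Strict monotonicity gives the uniqueness that [iota] requires; any solution at hand is therefore
    the selected one. *)
Lemma spectral_point_eq (m : Z) (P : params) (hl : Z) (x : R) :
  (1 <= m)%Z -> admissible P -> spectral_equation m P hl x ->
  spectral_point m P hl = x.
Proof.
intros Hm HP Hx; apply (spectral_eq_unique m P hl); trivial.
apply (iota_correct (spectral_equation m P hl)).
exists x; split; [exact Hx |].
intros y Hy; apply (spectral_eq_unique m P hl); trivial.
Qed.

(** Intermediate values: [spectral_fun] runs from [0] at [0] to [2 pi (m + 2)] at [pi], and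
    [1 <= hl + 1 <= m + 1] puts the target strictly between. *)
Lemma spectral_point_spec (m : Z) (P : params) (hl : Z) :
  (1 <= m)%Z -> admissible P -> (0 <= hl <= m)%Z ->
  spectral_fun m P (spectral_point m P hl) = 2 * PI * (IZR hl + 1) /\
  0 < spectral_point m P hl < PI.
Proof.
intros Hm HP [Hl0 Hlm].
apply IZR_le in Hl0; apply IZR_le in Hlm; pose proof PI_RGT_0.
destruct (IVT_gen (spectral_fun m P) 0 PI (2 * PI * (IZR hl + 1))) as [x [Hx Ex]].
- apply continuity_spectral_fun, HP.
- rewrite spectral_fun_0, spectral_fun_PI by exact HP.
  rewrite Rmin_left, Rmax_right by nra; nra.
- rewrite (spectral_point_eq m P hl x Hm HP Ex); split; [exact Ex |].
  rewrite Rmin_left, Rmax_right in Hx by lra.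
  split; apply Rnot_le_lt; intros L.
  + replace x with 0 in Ex by lra; rewrite spectral_fun_0 in Ex; nra.
  + replace x with PI in Ex by lra; rewrite spectral_fun_PI in Ex by exact HP; nra.
Qed.

(** With its mirror image below, this locates the root from the value of [spectral_fun] at a fixed
    test point, where limits in the parameters are easy to take. *)
Lemma spectral_point_gt (m : Z) (P : params) (hl : Z) (x : R) :
  (1 <= m)%Z -> admissible P -> (0 <= hl <= m)%Z ->
  spectral_fun m P x < 2 * PI * (IZR hl + 1) -> x < spectral_point m P hl.
Proof.
intros Hm HP Hl Hx; destruct (spectral_point_spec m P hl Hm HP Hl) as [E _].
apply Rnot_le_lt; intros [L | L].
- apply (spectral_fun_increasing m P _ _ Hm HP) in L; lra.
- rewrite L in E; lra.
Qed.

Lemma spectral_point_lt (m : Z) (P : params) (hl : Z) (x : R) :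
  (1 <= m)%Z -> admissible P -> (0 <= hl <= m)%Z ->
  2 * PI * (IZR hl + 1) < spectral_fun m P x -> spectral_point m P hl < x.
Proof.
intros Hm HP Hl Hx; destruct (spectral_point_spec m P hl Hm HP Hl) as [E _].
apply Rnot_le_lt; intros [L | L].
- apply (spectral_fun_increasing m P _ _ Hm HP) in L; lra.
- rewrite <- L in E; lra.
Qed.

(** * The kernel as an explicit real expression *)

Definition numer (a b : R) (l : Z) (x : R) : R :=
  sin (IZR l * x + x) - b * sin (IZR l * x) + a * sin (IZR l * x - x).

(** From [1 - exp (- 2 i x) = 2 i sin x exp (- i x)] one gets [c = (exp (i x) - b + a exp (- i x)) /
    (2 i sin x)] with [a = p_- q_-] and [b = p_- + q_-]. *)
Lemma c_explicit (P : params) (x : R) : sin x <> 0 ->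
  c P x = ((1 - a_minus P) / 2,
    (p_minus P + q_minus P - (1 + a_minus P) * cos x) / (2 * sin x)).
Proof.
intros Hs.
assert (E : cos x * cos x = 1 - sin x * sin x) by (pose proof (cos2_sin2 x); lra).
assert (S : (1 + - cos (2 * x)) * (1 + - cos (2 * x)) + sin (2 * x) * sin (2 * x)
   = 4 * (sin x * sin x)).
{ rewrite cos_2a_sin, sin_2a.
  replace (2 * sin x * cos x * (2 * sin x * cos x)) with (4 * sin x * sin x * (cos x * cos x)) by ring.
  rewrite E; ring. }
unfold c, a_minus, cis, Cdiv, Cinv, Cmult, Cminus, Cplus, Copp, RtoC; simpl.
rewrite !cos_neg, !sin_neg.
replace ((1 + - cos (2 * x)) * ((1 + - cos (2 * x)) * 1) +
     (0 + - - sin (2 * x)) * ((0 + - - sin (2 * x)) * 1)) with (4 * (sin x * sin x)) by (rewrite <- S; ring).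
rewrite cos_2a_sin, sin_2a.
apply injective_projections; simpl; field_simplify_eq; try (split; [lra | exact Hs]); try exact Hs;
 replace (cos x ^ 3) with (cos x * (cos x * cos x)) by ring;
 replace (cos x ^ 2) with (cos x * cos x) by ring;
 rewrite ?E; ring.
Qed.

(** [c P (- x)] is the conjugate of [c P x], so the product is a squared modulus, and
    [D q x = |1 - q exp (- i x)|^2]. *)
Lemma c_mul_c_opp (P : params) (x : R) : sin x <> 0 ->
  (c P x * c P (- x))%C =
    RtoC (D (p_minus P) x * D (q_minus P) x / (4 * sin x ^ 2)).
Proof.
intros Hs; rewrite c_opp, c_explicit by exact Hs.
assert (E : sin x ^ 2 = 1 - cos x ^ 2) by (pose proof (cos2_sin2 x); lra).
unfold Cmult, Cconj, RtoC, D, a_minus; simpl.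
apply injective_projections; simpl; [| field; exact Hs].
field_simplify_eq; [| exact Hs]; rewrite E; ring.
Qed.

Lemma poly_explicit (P : params) (l : Z) (x : R) : sin x <> 0 ->
  poly P l x = RtoC (numer (a_minus P) (p_minus P + q_minus P) l x / sin x).
Proof.
intros Hs; unfold poly; rewrite c_opp, c_explicit by exact Hs.
unfold numer, cis, Cmult, Cplus, Cconj, RtoC; simpl.
rewrite sin_plus, sin_minus, cos_neg, sin_neg.
apply injective_projections; simpl; field; exact Hs.
Qed.

Lemma H_explicit (m : Z) (P : params) (x : R) : admissible P ->
  H m P x = 2 * IZR m + (1 - p_minus P ^ 2) / D (p_minus P) x
    + (1 - q_minus P ^ 2) / D (q_minus P) x
    + (1 - p_plus P ^ 2) / D (p_plus P) x
    + (1 - q_plus P ^ 2) / D (q_plus P) x.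
Proof. intros [HP HP']; unfold H; rewrite !Derive_v by lra; reflexivity. Qed.

Lemma H_pos (m : Z) (P : params) (x : R) : (1 <= m)%Z -> admissible P -> 0 < H m P x.
Proof.
intros Hm HP; rewrite H_explicit by exact HP; destruct HP as [HP HP'].
apply IZR_le in Hm.
assert (A : forall q, -1 < q < 1 -> 0 < (1 - q ^ 2) / D q x).
{ intros q Hq; apply Rdiv_lt_0_compat; [nra | apply D_pos, Hq]. }
pose proof (A (p_minus P)); pose proof (A (q_minus P)).
pose proof (A (p_plus P)); pose proof (A (q_plus P)); lra.
Qed.

Lemma Delta_pos (m : Z) (P : params) (l : Z) : admissible P -> 0 < Delta m P l.
Proof.
intros [HP HP']; unfold Delta, a_minus, a_plus.
assert (A : forall (p q : R) k, -1 < p <= q -> q < 1 -> 0 < / (1 - p * q * INR (kron k))).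
{ intros p q k Hp Hq; apply Rinv_0_lt_compat; unfold kron; destruct (Z.eqb k 0); simpl; nra. }
apply Rmult_lt_0_compat; apply A; lra.
Qed.

(** [hat_Delta] contributes [(2 sin x)^2] under the root. As [sin x > 0] on (0, pi), it comes out as
    [2 sin x] and cancels the denominator of [poly]. *)
Lemma Psi_explicit (m : Z) (P : params) (hl l : Z) :
  (1 <= m)%Z -> admissible P -> (0 <= hl <= m)%Z ->
  let x := spectral_point m P hl in
  Psi m P hl l = RtoC (sqrt (Delta m P l / H m P x) *
    (2 * numer (a_minus P) (p_minus P + q_minus P) l x
      / sqrt (D (p_minus P) x * D (q_minus P) x))).
Proof.
intros Hm HP Hl x; unfold Psi, hat_Delta; cbv zeta; fold x.
destruct (spectral_point_spec m P hl Hm HP Hl) as [_ Hx]; fold x in Hx.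
assert (Hs : 0 < sin x) by (apply sin_gt_0; lra).
rewrite c_mul_c_opp, poly_explicit by lra.
pose proof (H_pos m P x Hm HP) as HH; pose proof (Delta_pos m P l HP) as HD.
assert (H1 : 0 < D (p_minus P) x) by (apply D_pos; destruct HP; lra).
assert (H2 : 0 < D (q_minus P) x) by (apply D_pos; destruct HP; lra).
assert (H12 := Rmult_lt_0_compat _ _ H1 H2).
rewrite <- (RtoC_mult _ (H m P x)), <- RtoC_div, <- RtoC_mult.
2:{ apply Rgt_not_eq, Rmult_lt_0_compat; [apply Rdiv_lt_0_compat; nra | exact HH]. }
f_equal; simpl.
replace (1 / _ * _) with ((Delta m P l / H m P x) * ((2 * sin x) ^ 2 / (D (p_minus P) x * D (q_minus P) x)))
  by (field; repeat split; lra).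
rewrite sqrt_mult_alt by (apply Rlt_le, Rdiv_lt_0_compat; lra).
rewrite (sqrt_div_alt ((2 * sin x) ^ 2)) by exact H12.
rewrite sqrt_pow2 by lra.
assert (HS := sqrt_lt_R0 _ H12).
field; split; apply Rgt_not_eq; assumption.
Qed.

(** * A calculus of real limits along a filter *)

Definition tends {T : Type} (F : (T -> Prop) -> Prop) (f : T -> R) (x : R) : Prop :=
  filterlim f F (locally x).

Section Tends.
Context {T : Type} (F : (T -> Prop) -> Prop) {FF : Filter F}.
Implicit Types (f g : T -> R) (x y : R).

Lemma tends_const x : tends F (fun _ => x) x.
Proof. apply filterlim_const. Qed.

Lemma tends_comp (h : R -> R) f x :
  tends F f x -> continuous h x -> tends F (fun t => h (f t)) (h x).
Proof. intros Hf Hh; exact (filterlim_comp _ _ _ _ _ _ _ _ Hf Hh). Qed.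

Lemma tends_plus f g x y :
  tends F f x -> tends F g y -> tends F (fun t => f t + g t) (x + y).
Proof.
intros Hf Hg.
exact (filterlim_comp_2 _ _ _ Hf Hg (filterlim_plus (V := R_NormedModule) x y)).
Qed.

Lemma tends_mult f g x y :
  tends F f x -> tends F g y -> tends F (fun t => f t * g t) (x * y).
Proof. intros Hf Hg; exact (filterlim_comp_2 _ _ _ Hf Hg (filterlim_mult x y)). Qed.

Lemma tends_opp f x : tends F f x -> tends F (fun t => - f t) (- x).
Proof.
intros Hf; apply (tends_comp Ropp); [exact Hf |].
apply (ex_derive_continuous Ropp); auto_derive; trivial.
Qed.

Lemma tends_minus f g x y :
  tends F f x -> tends F g y -> tends F (fun t => f t - g t) (x - y).
Proof. intros Hf Hg; apply tends_plus; [exact Hf | apply tends_opp, Hg]. Qed.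

Lemma tends_inv f x : x <> 0 -> tends F f x -> tends F (fun t => / f t) (/ x).
Proof.
intros Hx Hf; apply (tends_comp Rinv); [exact Hf |].
apply (ex_derive_continuous Rinv); auto_derive; trivial.
Qed.

Lemma tends_div f g x y :
  y <> 0 -> tends F f x -> tends F g y -> tends F (fun t => f t / g t) (x / y).
Proof. intros Hy Hf Hg; apply tends_mult; [exact Hf | apply tends_inv; trivial]. Qed.

Lemma tends_pow f x n : tends F f x -> tends F (fun t => f t ^ n) (x ^ n).
Proof.
intros Hf; induction n; simpl; [apply tends_const | apply tends_mult; trivial].
Qed.

Lemma tends_cos f x : tends F f x -> tends F (fun t => cos (f t)) (cos x).
Proof. intros Hf; apply (tends_comp cos); [exact Hf | apply continuous_cos]. Qed.

Lemma tends_sin f x : tends F f x -> tends F (fun t => sin (f t)) (sin x).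
Proof. intros Hf; apply (tends_comp sin); [exact Hf | apply continuous_sin]. Qed.

Lemma tends_atan f x : tends F f x -> tends F (fun t => atan (f t)) (atan x).
Proof. intros Hf; apply (tends_comp atan); [exact Hf | apply continuous_atan]. Qed.

Lemma tends_sqrt f x : tends F f x -> tends F (fun t => sqrt (f t)) (sqrt x).
Proof. intros Hf; apply (tends_comp sqrt); [exact Hf | apply continuous_sqrt]. Qed.

Lemma tends_eq f x y : tends F f x -> x = y -> tends F f y.
Proof. intros Hf <-; exact Hf. Qed.

Lemma tends_ext_loc f g x : F (fun t => f t = g t) -> tends F f x -> tends F g x.
Proof. intros E Hf; exact (filterlim_ext_loc f g E Hf). Qed.

Lemma tendsP f x :
  tends F f x <-> forall eps : posreal, F (fun t => Rabs (f t - x) < eps).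
Proof. exact (filterlim_locally (U := R_UniformSpace) f x). Qed.

Lemma tends_lt f x y : tends F f x -> x < y -> F (fun t => f t < y).
Proof.
intros Hf Hxy; assert (He : 0 < y - x) by lra.
apply filter_imp with (2 := proj1 (tendsP f x) Hf (mkposreal _ He)); simpl.
intros t Ht; apply Rabs_def2 in Ht; lra.
Qed.

Lemma tends_gt f x y : tends F f x -> y < x -> F (fun t => y < f t).
Proof.
intros Hf Hxy; assert (He : 0 < x - y) by lra.
apply filter_imp with (2 := proj1 (tendsP f x) Hf (mkposreal _ He)); simpl.
intros t Ht; apply Rabs_def2 in Ht; lra.
Qed.

Lemma tends_0_squeeze f g :
  F (fun t => 0 <= f t <= g t) -> tends F g 0 -> tends F f 0.
Proof.
intros Hfg Hg; apply tendsP; intros eps.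
generalize (filter_and _ _ Hfg (proj1 (tendsP g 0) Hg eps)); apply filter_imp.
intros t [H1 H2]; apply Rabs_def2 in H2; apply Rabs_def1; lra.
Qed.

(** The quotient is a difference quotient of [h] at [0]; [f] has to avoid [0] because the increment
    in a derivative is nonzero. *)
Lemma tends_derive_quotient (h : R -> R) (d : R) f :
  is_derive h 0 d -> h 0 = 0 -> F (fun t => f t <> 0) -> tends F f 0 ->
  tends F (fun t => h (f t) / f t) d.
Proof.
intros Hd H0 Hn Hf; apply is_derive_Reals in Hd.
apply tendsP; intros eps; destruct (Hd eps (cond_pos eps)) as [del Hdel].
generalize (filter_and _ _ Hn (proj1 (tendsP f 0) Hf del)); apply filter_imp.
intros t [H1 H2]; rewrite Rminus_0_r in H2; specialize (Hdel (f t) H1 H2).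
rewrite H0, Rplus_0_l, Rminus_0_r in Hdel; exact Hdel.
Qed.

Lemma tends_sinc f :
  F (fun t => f t <> 0) -> tends F f 0 -> tends F (fun t => sin (f t) / f t) 1.
Proof.
apply tends_derive_quotient; [| apply sin_0].
auto_derive; trivial; rewrite cos_0; ring.
Qed.

End Tends.

Ltac tends_tac :=
  repeat first
    [ eassumption
    | match goal with
      | |- tends _ (fun t => ?c) _ => apply tends_const
      | |- tends _ (fun t => _ + _) _ => apply tends_plus
      | |- tends _ (fun t => _ - _) _ => apply tends_minus
      | |- tends _ (fun t => _ * _) _ => apply tends_mult
      | |- tends _ (fun t => _ / _) _ => apply tends_div
      | |- tends _ (fun t => - _) _ => apply tends_opp
      | |- tends _ (fun t => / _) _ => apply tends_inv
      | |- tends _ (fun t => _ ^ _) _ => apply tends_pow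
      | |- tends _ (fun t => sin _) _ => apply tends_sin
      | |- tends _ (fun t => cos _) _ => apply tends_cos
      | |- tends _ (fun t => atan _) _ => apply tends_atan
      | |- tends _ (fun t => sqrt _) _ => apply tends_sqrt
      end ].

(** * Limit of the spectral point, and of the kernel at interior points *)

Definition sign_or_zero (e : R) : Prop := e = -1 \/ e = 0 \/ e = 1.

Lemma sign_or_zero_bounds (e : R) : sign_or_zero e -> -1 <= e <= 1.
Proof. intros [-> | [-> | ->]]; lra. Qed.

Section Functions.
Context {T : Type} (F : (T -> Prop) -> Prop) {FF : Filter F}.

Lemma tends_D (q y : T -> R) (e x : R) :
  tends F q e -> tends F y x -> tends F (fun t => D (q t) (y t)) (D e x).
Proof. intros Hq Hy; unfold D; tends_tac. Qed.

(** The right side interpolates the values [0], [x] and [pi] at [e = -1, 0, 1]. By half angles the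
    argument of [atan] is [- tan (x / 2)], [0] or [cot (x / 2)]. *)
Lemma v_closed_limit (e x : R) : sign_or_zero e -> 0 < x < PI ->
  v_closed e x = (1 - e ^ 2) * x + (e ^ 2 + e) / 2 * PI.
Proof.
intros He Hx.
assert (Hs : 0 < sin (x / 2)) by (apply sin_gt_0; lra).
assert (Hc : 0 < cos (x / 2)) by (apply cos_gt_0; lra).
assert (E2 : cos (x / 2) ^ 2 = 1 - sin (x / 2) ^ 2)
  by (pose proof (cos2_sin2 (x / 2)); lra).
unfold v_closed; replace (sin x) with (2 * sin (x / 2) * cos (x / 2))
  by (rewrite <- sin_2a; f_equal; field).
replace (cos x) with (1 - 2 * sin (x / 2) ^ 2)
  by (replace (cos x) with (cos (2 * (x / 2))) by (f_equal; field);
      rewrite cos_2a_sin; ring).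
destruct He as [-> | [-> | ->]].
- replace (_ / _) with (tan (- (x / 2))).
  + rewrite atan_tan by lra; field.
  + unfold tan; rewrite sin_neg, cos_neg.
    replace (1 - -1 * (1 - 2 * sin (x / 2) ^ 2)) with (2 * cos (x / 2) ^ 2) by lra.
    field; lra.
- replace (0 * _ / _) with 0 by (unfold Rdiv; ring).
  rewrite atan_0; field.
- replace (_ / _) with (tan (PI / 2 - x / 2)).
  + rewrite atan_tan by lra; field.
  + unfold tan; rewrite sin_shift, cos_shift; field; repeat split; nra.
Qed.

(** The integrand of [v] degenerates as [q] tends to 1 or -1, but the closed form is jointly
    continuous wherever [1 - e cos x] is nonzero. *)
Lemma tends_v (q y : T -> R) (e x : R) : e * cos x <> 1 ->
  F (fun t => -1 < q t < 1) -> tends F q e -> tends F y x ->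
  tends F (fun t => v (q t) (y t)) (v_closed e x).
Proof.
intros Hex Hq Hqe Hy.
apply tends_ext_loc with (f := fun t => v_closed (q t) (y t)); trivial.
- revert Hq; apply filter_imp; intros t Ht; symmetry; apply v_eq, Ht.
- unfold v_closed; tends_tac; lra.
Qed.

End Functions.

(** An arbitrary family along a filter, so that the limit at 0 can later be applied to the reflected
    parameters. *)
Definition tends_params {T : Type} (F : (T -> Prop) -> Prop) (P : T -> params) (P0 : params) : Prop :=
  F (fun t => admissible (P t)) /\
  tends F (fun t => p_minus (P t)) (p_minus P0) /\
  tends F (fun t => q_minus (P t)) (q_minus P0) /\
  tends F (fun t => p_plus (P t)) (p_plus P0) /\
  tends F (fun t => q_plus (P t)) (q_plus P0).

(* The sixteen limit points of the DCT and DST list. *)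
Definition extremal (P : params) : Prop :=
  ((p_minus P = -1 \/ p_minus P = 0) /\ (q_minus P = 0 \/ q_minus P = 1)) /\
  ((p_plus P = -1 \/ p_plus P = 0) /\ (q_plus P = 0 \/ q_plus P = 1)).

Definition kernel (m : Z) (P : params) (l : Z) (x : R) : R :=
  sqrt (Delta m P l / H m P x) *
    (2 * numer (a_minus P) (p_minus P + q_minus P) l x
      / sqrt (D (p_minus P) x * D (q_minus P) x)).

(* Half the limit of [H] at a point of (0, pi). *)
Definition order (m : Z) (P : params) : R :=
  IZR m + ((1 - p_minus P ^ 2) + (1 - q_minus P ^ 2)
    + (1 - p_plus P ^ 2) + (1 - q_plus P ^ 2)) / 2.

(** Root of the limiting spectral equation, which is affine on (0, pi): [2 order x + (q_- + q_+) pi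
    = 2 pi (hl + 1)]. *)
Definition limit_point (m : Z) (P : params) (hl : Z) : R :=
  PI * (IZR hl + 1 - (q_minus P + q_plus P) / 2) / order m P.

Section Limits.
Context {T : Type} (F : (T -> Prop) -> Prop) {FF : Filter F}.
Variables (m hl l : Z) (P : T -> params) (P0 : params).
Hypotheses (hm : (1 <= m)%Z) (hhl : (0 <= hl <= m)%Z) (hP : tends_params F P P0) (hP0 : extremal P0).

Let xi (t : T) : R := spectral_point m (P t) hl.

Lemma order_pos : 0 < order m P0.
Proof.
assert (1 <= IZR m) by (apply IZR_le; exact hm); unfold order.
destruct hP0 as [[[-> | ->] [-> | ->]] [[-> | ->] [-> | ->]]]; lra.
Qed.

Lemma eventually_spectral_point :
  F (fun t => admissible (P t) /\
     spectral_fun m (P t) (xi t) = 2 * PI * (IZR hl + 1) /\ 0 < xi t < PI).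
Proof.
generalize (proj1 hP); apply filter_imp; intros t Ht; split; [exact Ht |].
apply spectral_point_spec; trivial.
Qed.

Lemma eventually_bounds :
  F (fun t => -1 < p_minus (P t) < 1) /\ F (fun t => -1 < q_minus (P t) < 1) /\
  F (fun t => -1 < p_plus (P t) < 1) /\ F (fun t => -1 < q_plus (P t) < 1).
Proof.
repeat split; generalize (proj1 hP); apply filter_imp; intros t [? ?]; lra.
Qed.

Lemma tends_spectral_fun (x : R) : 0 < x < PI ->
  tends F (fun t => spectral_fun m (P t) x)
    (2 * order m P0 * x + (q_minus P0 + q_plus P0) * PI).
Proof.
intros Hx; destruct eventually_bounds as [B1 [B2 [B3 B4]]].
destruct hP as [_ [T1 [T2 [T3 T4]]]].
assert (S : sign_or_zero (p_minus P0) /\ sign_or_zero (q_minus P0) /\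
  sign_or_zero (p_plus P0) /\ sign_or_zero (q_plus P0)).
{ unfold sign_or_zero; unfold extremal in hP0; tauto. }
destruct S as [S1 [S2 [S3 S4]]].
assert (A : forall e, sign_or_zero e -> e * cos x <> 1).
{ intros e He; pose proof (one_minus_qcos_pos_interior e x (sign_or_zero_bounds e He) Hx); lra. }
eapply tends_eq.
- unfold spectral_fun.
  repeat (apply tends_plus; [exact FF | |]); [apply tends_const, FF | ..];
  (eapply tends_v; [exact FF | | | eassumption | apply tends_const, FF]; [apply A |]; assumption).
- rewrite !v_closed_limit by trivial; unfold order.
  destruct hP0 as [[[-> | ->] [-> | ->]] [[-> | ->] [-> | ->]]]; field.
Qed.

(** The root is trapped between test points at distance [eps] from the limit, where the limiting
    affine function of positive slope lies strictly below or above the target. The endpoints 0 and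
    pi are allowed. *)
Lemma tends_spectral_point : 0 <= limit_point m P0 hl <= PI ->
  tends F xi (limit_point m P0 hl).
Proof.
intros Hb; apply (tendsP F); intros eps; pose proof (cond_pos eps).
pose proof order_pos as HM; pose proof PI_RGT_0.
assert (E : 2 * order m P0 * limit_point m P0 hl + (q_minus P0 + q_plus P0) * PI
   = 2 * PI * (IZR hl + 1)) by (unfold limit_point; field; lra).
assert (L : F (fun t => limit_point m P0 hl - eps < xi t)).
{ destruct (Rle_lt_dec (limit_point m P0 hl - eps) 0) as [C | C].
  - generalize eventually_spectral_point; apply filter_imp; intros t Ht; lra.
  - assert (Hx : 0 < limit_point m P0 hl - eps < PI) by lra.
    assert (Hlt := tends_lt F _ _ (2 * PI * (IZR hl + 1)) (tends_spectral_fun _ Hx)).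
    assert (Hv := Rmult_lt_0_compat _ _ HM (cond_pos eps)).
    generalize (filter_and _ _ (proj1 hP) (Hlt ltac:(lra))); apply filter_imp.
    intros t [Ht Ht']; exact (spectral_point_gt m (P t) hl _ hm Ht hhl Ht'). }
assert (U : F (fun t => xi t < limit_point m P0 hl + eps)).
{ destruct (Rle_lt_dec PI (limit_point m P0 hl + eps)) as [C | C].
  - generalize eventually_spectral_point; apply filter_imp; intros t Ht; lra.
  - assert (Hx : 0 < limit_point m P0 hl + eps < PI) by lra.
    assert (Hgt := tends_gt F _ _ (2 * PI * (IZR hl + 1)) (tends_spectral_fun _ Hx)).
    assert (Hv := Rmult_lt_0_compat _ _ HM (cond_pos eps)).
    generalize (filter_and _ _ (proj1 hP) (Hgt ltac:(lra))); apply filter_imp.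
    intros t [Ht Ht']; exact (spectral_point_lt m (P t) hl _ hm Ht hhl Ht'). }
generalize (filter_and _ _ L U); apply filter_imp; intros t [H1 H2].
apply Rabs_def1; lra.
Qed.

Lemma tends_Delta : tends F (fun t => Delta m (P t) l) (Delta m P0 l).
Proof.
destruct hP as [_ [T1 [T2 [T3 T4]]]].
unfold Delta, a_minus, a_plus; tends_tac.
(* At an extremal point [p q] is [0] or [-1], so the denominators of [Delta] tend to 1 or 2. *)
all: unfold kron; destruct (Z.eqb _ 0); simpl;
  destruct hP0 as [[[E1 | E1] [E2 | E2]] [[E3 | E3] [E4 | E4]]];
  rewrite ?E1, ?E2, ?E3, ?E4; lra.
Qed.

Lemma tends_numer (y : T -> R) (x : R) : tends F y x ->
  tends F (fun t => numer (a_minus (P t)) (p_minus (P t) + q_minus (P t)) l (y t))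
    (numer (a_minus P0) (p_minus P0 + q_minus P0) l x).
Proof.
intros Hy; destruct hP as [_ [T1 [T2 [T3 T4]]]].
unfold numer, a_minus; tends_tac.
Qed.

Lemma D_pos_extremal (e x : R) : 0 < x < PI -> sign_or_zero e -> 0 < D e x.
Proof.
intros Hx He; apply D_pos_of, one_minus_qcos_pos_interior, Hx.
apply sign_or_zero_bounds, He.
Qed.

Lemma tends_kernel_interior : 0 < limit_point m P0 hl < PI ->
  tends F (fun t => kernel m (P t) l (xi t))
    (sqrt (Delta m P0 l / (2 * order m P0)) *
      (2 * numer (a_minus P0) (p_minus P0 + q_minus P0) l (limit_point m P0 hl)
        / sqrt (D (p_minus P0) (limit_point m P0 hl) * D (q_minus P0) (limit_point m P0 hl)))).
Proof.
intros Hx; assert (Hxi := tends_spectral_point ltac:(lra)).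
set (x := limit_point m P0 hl) in *.
assert (S : sign_or_zero (p_minus P0) /\ sign_or_zero (q_minus P0) /\
  sign_or_zero (p_plus P0) /\ sign_or_zero (q_plus P0)).
{ unfold sign_or_zero; unfold extremal in hP0; tauto. }
destruct S as [S1 [S2 [S3 S4]]].
pose proof (D_pos_extremal _ x Hx S1) as D1.
pose proof (D_pos_extremal _ x Hx S2) as D2.
pose proof (D_pos_extremal _ x Hx S3) as D3.
pose proof (D_pos_extremal _ x Hx S4) as D4.
assert (TN := tends_numer xi x Hxi).
assert (TDelta := tends_Delta).
destruct hP as [HA [T1 [T2 [T3 T4]]]].
assert (TD1 := tends_D F _ _ _ _ T1 Hxi); assert (TD2 := tends_D F _ _ _ _ T2 Hxi).
assert (TD3 := tends_D F _ _ _ _ T3 Hxi); assert (TD4 := tends_D F _ _ _ _ T4 Hxi).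
assert (TH : tends F (fun t => H m (P t) (xi t)) (2 * order m P0)).
{ eapply tends_ext_loc with
   (f := fun t => 2 * IZR m + (1 - p_minus (P t) ^ 2) / D (p_minus (P t)) (xi t)
    + (1 - q_minus (P t) ^ 2) / D (q_minus (P t)) (xi t)
    + (1 - p_plus (P t) ^ 2) / D (p_plus (P t)) (xi t)
    + (1 - q_plus (P t) ^ 2) / D (q_plus (P t)) (xi t)); trivial.
  - revert HA; apply filter_imp; intros t Ht; symmetry; apply H_explicit, Ht.
  - eapply tends_eq; [tends_tac; apply Rgt_not_eq; assumption |].
    (* The term vanishes for [e = -1] and [e = 1], and [D 0 x = 1]; hence the limit of [H] does not
       depend on the interior point. *)
    assert (Q : forall e, sign_or_zero e -> 0 < D e x -> (1 - e ^ 2) / D e x = 1 - e ^ 2).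
    { intros e [-> | [-> | ->]]; unfold D; intros; field; lra. }
    rewrite !Q by trivial; unfold order; field. }
pose proof order_pos.
unfold kernel; tends_tac.
- lra.
- apply Rgt_not_eq, sqrt_lt_R0, Rmult_lt_0_compat; assumption.
Qed.

End Limits.

(** * The kernel when the spectral point tends to 0 *)

Section LimitAtZero.
Context {T : Type} (F : (T -> Prop) -> Prop) {FF : Filter F}.

Lemma v_bounds (q x : R) : -1 < q < 1 -> 0 < x < PI -> 0 < v q x < PI.
Proof.
intros Hq [Hx0 HxPI].
pose proof (v_increasing q 0 x Hq Hx0); pose proof (v_increasing q x PI Hq HxPI).
rewrite v_0 in *; rewrite v_PI in * by exact Hq; lra.
Qed.

(** Divide [D sin v = (1 - p^2) sin x] by [x v] and use [sin y / y -> 1] for both angles. As [e] is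
    not 1, [D e 0 = (1 - e)^2] is nonzero, and [(1 - e^2) / (1 - e)^2] equals [1 - e^2] at
    [e = -1, 0]. *)
Lemma tends_v_quotient (p x : T -> R) (e : R) : e = -1 \/ e = 0 ->
  F (fun t => -1 < p t < 1) -> F (fun t => 0 < x t < PI) ->
  tends F p e -> tends F x 0 ->
  tends F (fun t => v (p t) (x t)) 0 /\
  tends F (fun t => v (p t) (x t) / x t) (1 - e ^ 2).
Proof.
intros He Hp Hx Tp Tx.
assert (Tv : tends F (fun t => v (p t) (x t)) 0).
{ eapply tends_eq; [apply (tends_v F); try eassumption; rewrite cos_0; lra |].
  unfold v_closed; rewrite sin_0.
  replace (e * 0 / _) with 0 by (unfold Rdiv; ring); rewrite atan_0; ring. }
split; [exact Tv |].
assert (Hpx := filter_and _ _ Hp Hx).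
assert (N1 : F (fun t => x t <> 0)) by (revert Hx; apply filter_imp; intros; lra).
assert (N2 : F (fun t => v (p t) (x t) <> 0)).
{ revert Hpx; apply filter_imp; intros t [H1 H2]; pose proof (v_bounds _ _ H1 H2); lra. }
apply (tends_ext_loc F) with (f := fun t =>
  (1 - p t ^ 2) / D (p t) (x t) * (sin (x t) / x t)
   / (sin (v (p t) (x t)) / v (p t) (x t))); trivial.
- revert Hpx; apply filter_imp; intros t [H1 H2].
  pose proof (v_bounds _ _ H1 H2) as H3.
  assert (0 < sin (v (p t) (x t))) by (apply sin_gt_0; lra).
  destruct (cos_sin_v (p t) (x t) H1) as [_ E].
  pose proof (D_pos (p t) (x t) H1).
  replace (sin (x t) / x t) with ((1 - p t ^ 2) * sin (x t) / (x t * (1 - p t ^ 2)))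
    by (field; split; nra).
  rewrite <- E; field; repeat split; nra.
- assert (TD := tends_D F _ _ _ _ Tp Tx).
  eapply tends_eq.
  + apply (tends_div F); [apply R1_neq_R0 | | apply (tends_sinc F); trivial].
    apply (tends_mult F); [| apply (tends_sinc F); trivial].
    tends_tac; unfold D; rewrite cos_0; destruct He as [-> | ->]; lra.
  + unfold D; rewrite cos_0; destruct He as [-> | ->]; field.
Qed.

(* From [1 - cos (v q x) = (1 + q)^2 (1 - cos x) / D q x]. *)
Lemma tends_D_sin2 (q x : T -> R) :
  F (fun t => -1 < q t < 1) -> F (fun t => 0 < x t < PI) ->
  tends F q 1 -> tends F x 0 -> tends F (fun t => v (q t) (x t)) PI ->
  tends F (fun t => D (q t) (x t) / sin (x t) ^ 2) 1.
Proof.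
intros Hq Hx Tq Tx Tv.
apply (tends_ext_loc F) with (f := fun t =>
  (1 + q t) ^ 2 / ((1 + cos (x t)) * (1 - cos (v (q t) (x t))))); trivial.
- generalize (filter_and _ _ Hq Hx); apply filter_imp; intros t [H1 H2].
  destruct (cos_sin_v (q t) (x t) H1) as [E _].
  assert (Hs : 0 < sin (x t)) by (apply sin_gt_0; lra).
  assert (E2 : sin (x t) ^ 2 = 1 - cos (x t) ^ 2) by (pose proof (cos2_sin2 (x t)); lra).
  pose proof (D_pos (q t) (x t) H1) as HD.
  assert (E3 : 1 - cos (v (q t) (x t)) = (1 + q t) ^ 2 * (1 - cos (x t)) / D (q t) (x t)).
  { apply (Rmult_eq_reg_l (D (q t) (x t))); [| lra].
    rewrite Rmult_minus_distr_l, E; unfold D in HD |- *; field; lra. }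
  assert (0 < 1 - cos (x t) /\ 0 < 1 + cos (x t)).
  { pose proof (COS_bound (x t)); split; nra. }
  rewrite E3, E2; field; repeat split; nra.
- eapply tends_eq.
  + tends_tac; rewrite cos_0, cos_PI; lra.
  + rewrite cos_0, cos_PI; field.
Qed.

Lemma tends_sin_mul_quotient (x : T -> R) (k : R) :
  F (fun t => 0 < x t < PI) -> tends F x 0 ->
  tends F (fun t => sin (k * x t) / sin (x t)) k.
Proof.
intros Hx Tx.
assert (N : F (fun t => x t <> 0)) by (revert Hx; apply filter_imp; intros; lra).
apply (tends_ext_loc F) with (f := fun t => (sin (k * x t) / x t) / (sin (x t) / x t)); trivial.
- revert Hx; apply filter_imp; intros t Ht.
  assert (0 < sin (x t)) by (apply sin_gt_0; lra); field; lra.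
- eapply tends_eq.
  + apply (tends_div F); [apply R1_neq_R0 | | apply (tends_sinc F); trivial].
    apply (tends_derive_quotient F (fun y => sin (k * y)) k); trivial.
    * auto_derive; trivial; rewrite Rmult_0_r, cos_0; ring.
    * rewrite Rmult_0_r; apply sin_0.
  + field.
Qed.

Variables (m l : Z) (P : T -> params) (P0 : params).
Hypotheses (hm : (1 <= m)%Z) (hP : tends_params F P P0) (hP0 : extremal P0)
  (hq1 : q_minus P0 = 1) (hq2 : q_plus P0 = 1).

Let xi (t : T) : R := spectral_point m (P t) 0.

Lemma limit_point_0 : limit_point m P0 0 = 0.
Proof.
unfold limit_point; rewrite hq1, hq2.
replace (0 + 1 - (1 + 1) / 2) with 0 by field; unfold Rdiv; ring.
Qed.

Lemma tends_spectral_point_0 : tends F xi 0.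
Proof.
assert (E := limit_point_0); pose proof PI_RGT_0.
eapply tends_eq; [apply (tends_spectral_point F m 0 P P0 hm); trivial; [lia | lra] | exact E].
Qed.

(* Near [0] the angles [w = PI - v q xi] satisfy, by the spectral equation,
   [w_- + w_+ = 2 m xi + v p_- xi + v p_+ xi], and [(v q)' xi = sin w / sin xi]:
   the two derivatives add up to about [(w_- + w_+) / xi]. *)
Lemma tends_kernel_at_0 :
  tends F (fun t => kernel m (P t) l (xi t))
    (2 * sqrt (Delta m P0 l / (4 * order m P0))).
Proof.
assert (TDelta := tends_Delta F m l P P0 hP hP0).
destruct (eventually_bounds F P P0 hP) as [B1 [B2 [B3 B4]]].
assert (HE := eventually_spectral_point F m 0 P P0 hm ltac:(lia) hP).
assert (Tx := tends_spectral_point_0).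
destruct hP as [HA [T1 [T2 [T3 T4]]]].
rewrite hq1 in T2; rewrite hq2 in T4.
assert (He1 : p_minus P0 = -1 \/ p_minus P0 = 0) by (unfold extremal in hP0; tauto).
assert (He2 : p_plus P0 = -1 \/ p_plus P0 = 0) by (unfold extremal in hP0; tauto).
assert (Hx : F (fun t => 0 < xi t < PI)) by (revert HE; apply filter_imp; tauto).
destruct (tends_v_quotient _ _ _ He1 B1 Hx T1 Tx) as [V1 V1'].
destruct (tends_v_quotient _ _ _ He2 B3 Hx T3 Tx) as [V3 V3'].
set (w1 := fun t => PI - v (q_minus (P t)) (xi t)).
set (w2 := fun t => PI - v (q_plus (P t)) (xi t)).
assert (HW : F (fun t => 0 < w1 t /\ 0 < w2 t /\ 0 < xi t < PI /\
  w1 t + w2 t = 2 * IZR m * xi t + v (p_minus (P t)) (xi t) + v (p_plus (P t)) (xi t))).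
{ generalize (filter_and _ _ HE (filter_and _ _ B2 B4)); apply filter_imp.
  unfold spectral_fun; intros t [[_ [E Ht]] [b2 b4]].
  change (spectral_point m (P t) 0) with (xi t) in *.
  pose proof (v_bounds _ _ b2 Ht); pose proof (v_bounds _ _ b4 Ht).
  unfold w1, w2; repeat split; lra. }
(* The sum tends to 0 by the spectral equation; both angles being positive, each of them then tends
   to 0 by squeezing. *)
assert (TW : tends F (fun t => w1 t + w2 t) 0).
{ apply (tends_ext_loc F) with (f := fun t =>
    2 * IZR m * xi t + v (p_minus (P t)) (xi t) + v (p_plus (P t)) (xi t));
    [| eapply tends_eq].
  - revert HW; apply filter_imp; intros t [_ [_ [_ E]]]; symmetry; exact E.
  - tends_tac.
  - ring. }
assert (Tw1 : tends F w1 0).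
{ apply (tends_0_squeeze F) with (g := fun t => w1 t + w2 t); trivial.
  revert HW; apply filter_imp; intros t Ht; lra. }
assert (Tw2 : tends F w2 0).
{ apply (tends_0_squeeze F) with (g := fun t => w1 t + w2 t); trivial.
  revert HW; apply filter_imp; intros t Ht; lra. }
assert (Nx : F (fun t => xi t <> 0)) by (revert Hx; apply filter_imp; intros; lra).
assert (EM : order m P0 = IZR m + ((1 - p_minus P0 ^ 2) + (1 - p_plus P0 ^ 2)) / 2)
  by (unfold order; rewrite hq1, hq2; field).
assert (TWx : tends F (fun t => (w1 t + w2 t) / xi t) (2 * order m P0)).
{ eapply (tends_ext_loc F) with (f := fun t => 2 * IZR m
     + v (p_minus (P t)) (xi t) / xi t + v (p_plus (P t)) (xi t) / xi t); trivial.
  - revert HW; apply filter_imp; intros t [_ [_ [Ht E]]]; rewrite E; field; lra.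
  - eapply tends_eq; [tends_tac |]; rewrite EM; field. }
(* Separately [w1 / xi] and [w2 / xi] need not converge, as the two [q] may approach 1 at different
   rates. Sum-to-product on [sin w1 + sin w2] brings in only the sum, whose quotient by [xi] is
   known, and a cosine tending to 1. *)
assert (TQ : tends F (fun t => (1 - q_minus (P t) ^ 2) / D (q_minus (P t)) (xi t)
    + (1 - q_plus (P t) ^ 2) / D (q_plus (P t)) (xi t)) (2 * order m P0)).
{ eapply (tends_ext_loc F) with (f := fun t =>
    sin ((w1 t + w2 t) / 2) / ((w1 t + w2 t) / 2) * ((w1 t + w2 t) / xi t)
     / (sin (xi t) / xi t) * cos ((w1 t - w2 t) / 2)); trivial.
  - generalize (filter_and _ _ HW (filter_and _ _ B2 B4)); apply filter_imp.
    intros t [[H1 [H2 [H3 _]]] [b2 b4]].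
    assert (0 < sin (xi t)) by (apply sin_gt_0; lra).
    destruct (cos_sin_v _ (xi t) b2) as [_ E2]; destruct (cos_sin_v _ (xi t) b4) as [_ E4].
    pose proof (D_pos _ (xi t) b2); pose proof (D_pos _ (xi t) b4).
    transitivity ((sin (w1 t) + sin (w2 t)) / sin (xi t)).
    + rewrite form3; field; lra.
    + unfold w1, w2; rewrite !sin_PI_x.
      replace (1 - q_minus (P t) ^ 2) with
        (D (q_minus (P t)) (xi t) * sin (v (q_minus (P t)) (xi t)) / sin (xi t))
        by (rewrite E2; field; lra).
      replace (1 - q_plus (P t) ^ 2) with
        (D (q_plus (P t)) (xi t) * sin (v (q_plus (P t)) (xi t)) / sin (xi t))
        by (rewrite E4; field; lra).
      field; lra.
  - eapply tends_eq.
    + apply (tends_mult F); [apply (tends_div F);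
       [apply R1_neq_R0 | apply (tends_mult F); [| exact TWx] | apply (tends_sinc F); trivial] |].
      * apply (tends_sinc F); trivial.
        -- revert HW; apply filter_imp; intros t Ht; lra.
        -- eapply tends_eq; [tends_tac; lra | field].
      * tends_tac; lra.
    + replace ((0 - 0) / 2) with 0 by field. rewrite cos_0; field. }
assert (TD1 := tends_D F _ _ _ _ T1 Tx); assert (TD3 := tends_D F _ _ _ _ T3 Tx).
assert (D1 : D (p_minus P0) 0 = (1 - p_minus P0) ^ 2) by (unfold D; rewrite cos_0; ring).
assert (D3 : D (p_plus P0) 0 = (1 - p_plus P0) ^ 2) by (unfold D; rewrite cos_0; ring).
(* The terms without [q] give [2 order] as in the interior; the two [q] terms, which vanish there,
   add another [2 order]. *)
assert (TH : tends F (fun t => H m (P t) (xi t)) (4 * order m P0)).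
{ eapply (tends_ext_loc F) with
   (f := fun t => 2 * IZR m + (1 - p_minus (P t) ^ 2) / D (p_minus (P t)) (xi t)
    + (1 - p_plus (P t) ^ 2) / D (p_plus (P t)) (xi t)
    + ((1 - q_minus (P t) ^ 2) / D (q_minus (P t)) (xi t)
    + (1 - q_plus (P t) ^ 2) / D (q_plus (P t)) (xi t))); trivial.
  - revert HA; apply filter_imp; intros t Ht; rewrite H_explicit by exact Ht; ring.
  - eapply tends_eq.
    + apply (tends_plus F); [| exact TQ].
      tends_tac; [rewrite D1; destruct He1 as [-> | ->] | rewrite D3; destruct He2 as [-> | ->]]; lra.
    + rewrite EM, D1, D3; destruct He1 as [-> | ->]; destruct He2 as [-> | ->]; field. }
(* The limit is [(l + 1) - (p_- + 1) l + p_- (l - 1)], from which [l] cancels. *)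
assert (TN : tends F (fun t => numer (a_minus (P t)) (p_minus (P t) + q_minus (P t)) l (xi t)
    / sin (xi t)) (1 - p_minus P0)).
{ eapply (tends_ext_loc F) with (f := fun t =>
    sin ((IZR l + 1) * xi t) / sin (xi t)
    - (p_minus (P t) + q_minus (P t)) * (sin (IZR l * xi t) / sin (xi t))
    + p_minus (P t) * q_minus (P t) * (sin ((IZR l - 1) * xi t) / sin (xi t))); trivial.
  - revert Hx; apply filter_imp; intros t Ht.
    assert (0 < sin (xi t)) by (apply sin_gt_0; lra).
    unfold numer, a_minus; rewrite Rmult_plus_distr_r, Rmult_minus_distr_r, Rmult_1_l.
    field; lra.
  - assert (S := fun k => tends_sin_mul_quotient xi k Hx Tx).
    eapply tends_eq.
    + apply (tends_plus F); [apply (tends_minus F); [apply S |] |];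
       apply (tends_mult F); try apply S; tends_tac.
    + ring. }
assert (TDs : tends F (fun t => D (q_minus (P t)) (xi t) / sin (xi t) ^ 2) 1).
{ apply tends_D_sin2; trivial.
  eapply (tends_ext_loc F) with (f := fun t => PI - w1 t); trivial.
  - apply filter_forall; intros t; unfold w1; ring.
  - eapply tends_eq; [tends_tac | ring]. }
assert (HM := order_pos m P0 hm hP0).
(* Numerator and root both vanish in the limit. Dividing each by [sin xi] makes both tend to
   [1 - p_-], so that only the factor 2 remains. *)
eapply (tends_ext_loc F) with (f := fun t => sqrt (Delta m (P t) l / H m (P t) (xi t)) *
  (2 * (numer (a_minus (P t)) (p_minus (P t) + q_minus (P t)) l (xi t) / sin (xi t))
    / sqrt (D (p_minus (P t)) (xi t) * (D (q_minus (P t)) (xi t) / sin (xi t) ^ 2)))); trivial.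
- generalize (filter_and _ _ Hx (filter_and _ _ B1 B2)); apply filter_imp.
  intros t [Ht [b1 b2]].
  assert (Hs : 0 < sin (xi t)) by (apply sin_gt_0; lra).
  pose proof (D_pos _ (xi t) b1); pose proof (D_pos _ (xi t) b2).
  unfold kernel; f_equal.
  replace (D (p_minus (P t)) (xi t) * (D (q_minus (P t)) (xi t) / sin (xi t) ^ 2))
   with (D (p_minus (P t)) (xi t) * D (q_minus (P t)) (xi t) / sin (xi t) ^ 2) by (field; lra).
  rewrite sqrt_div_alt by nra; rewrite sqrt_pow2 by lra.
  assert (0 < sqrt (D (p_minus (P t)) (xi t) * D (q_minus (P t)) (xi t)))
    by (apply sqrt_lt_R0; nra).
  field; lra.
- assert (E : sqrt (D (p_minus P0) 0 * 1) = 1 - p_minus P0).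
  { rewrite D1, Rmult_1_r; apply sqrt_pow2; lra. }
  eapply tends_eq; [tends_tac; lra |].
  rewrite E; field; lra.
Qed.

End LimitAtZero.

(** * Reflection symmetry and the kernel when the spectral point tends to pi *)

(* Accompanies the substitution [x -> PI - x]. *)
Definition reflect (P : params) : params :=
  ((- q_minus P, - p_minus P), (- q_plus P, - p_plus P)).

Lemma admissible_reflect (P : params) : admissible P -> admissible (reflect P).
Proof.
unfold admissible, reflect, p_minus, q_minus, p_plus, q_plus; simpl; lra.
Qed.

(** By [v_reflect], reflection turns the value [s] of [spectral_fun] into [2 pi (m + 2) - s], hence
    [hl + 1] into [(m - hl) + 1]. *)
Lemma spectral_point_reflect (m : Z) (P : params) (hl : Z) :
  (1 <= m)%Z -> admissible P -> (0 <= hl <= m)%Z ->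
  spectral_point m (reflect P) (m - hl) = PI - spectral_point m P hl.
Proof.
intros Hm HP Hl; apply spectral_point_eq; [exact Hm | apply admissible_reflect, HP |].
destruct (spectral_point_spec m P hl Hm HP Hl) as [E _].
unfold spectral_fun in E; unfold spectral_equation.
unfold reflect, p_minus, q_minus, p_plus, q_plus in *; simpl in *.
destruct HP as [HP HP']; unfold p_minus, q_minus, p_plus, q_plus in *.
rewrite !v_reflect, minus_IZR by lra; nra.
Qed.

Lemma D_reflect (q x : R) : D (- q) (PI - x) = D q x.
Proof. unfold D; rewrite Rtrigo_facts.cos_pi_minus; ring. Qed.

Lemma sin_IZR_PI (l : Z) : sin (IZR l * PI) = 0.
Proof. apply sin_eq_0_1; exists l; reflexivity. Qed.

(** Reflection preserves [p q] and negates [p + q]. The factor [cos (l pi)] is the sign [(-1)^l] for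
    an integer [l]. *)
Lemma numer_reflect (a b : R) (l : Z) (x : R) :
  numer a (- b) l (PI - x) = cos (IZR l * PI) * numer a b l x.
Proof.
unfold numer.
replace (IZR l * (PI - x) + (PI - x)) with (IZR l * PI + (PI - (IZR l * x + x))) by ring.
replace (IZR l * (PI - x) - (PI - x)) with (IZR l * PI - (PI + (IZR l * x - x))) by ring.
replace (IZR l * (PI - x)) with (IZR l * PI - IZR l * x) by ring.
repeat rewrite ?sin_plus, ?sin_minus, ?cos_plus, ?cos_minus.
rewrite sin_IZR_PI, sin_PI, cos_PI; ring.
Qed.

Lemma Delta_reflect (m : Z) (P : params) (l : Z) : Delta m (reflect P) l = Delta m P l.
Proof.
unfold Delta, a_minus, a_plus, reflect, p_minus, q_minus, p_plus, q_plus; simpl.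
rewrite !Rmult_opp_opp, (Rmult_comm (snd (fst P))), (Rmult_comm (snd (snd P))).
reflexivity.
Qed.

Lemma H_reflect (m : Z) (P : params) (x : R) : admissible P ->
  H m (reflect P) (PI - x) = H m P x.
Proof.
intros HP; rewrite !H_explicit by (try apply admissible_reflect; exact HP).
unfold reflect, p_minus, q_minus, p_plus, q_plus; simpl fst; simpl snd.
rewrite !D_reflect; unfold Rdiv; ring.
Qed.

Lemma kernel_reflect (m : Z) (P : params) (l : Z) (x : R) : admissible P ->
  kernel m (reflect P) l (PI - x) = cos (IZR l * PI) * kernel m P l x.
Proof.
intros HP; unfold kernel; rewrite Delta_reflect, H_reflect by exact HP.
unfold a_minus, reflect, p_minus, q_minus; simpl fst; simpl snd.
rewrite !D_reflect.
replace (- snd (fst P) * - fst (fst P)) with (fst (fst P) * snd (fst P)) by ring.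
replace (- snd (fst P) + - fst (fst P)) with (- (fst (fst P) + snd (fst P))) by ring.
rewrite numer_reflect, (Rmult_comm (D (snd (fst P)) x)); unfold Rdiv; ring.
Qed.

Section Main.
Context {T : Type} (F : (T -> Prop) -> Prop) {FF : Filter F}.
Variables (m l : Z) (P : T -> params) (P0 : params).
Hypotheses (hm : (1 <= m)%Z) (hP : tends_params F P P0) (hP0 : extremal P0).

(** The reflected family has both [q] tending to 1 and spectral index [m - m = 0], so the limit at 0
    applies to it. *)
Lemma tends_kernel_at_PI : p_minus P0 = -1 -> p_plus P0 = -1 ->
  tends F (fun t => kernel m (P t) l (spectral_point m (P t) m))
    (cos (IZR l * PI) * (2 * sqrt (Delta m P0 l / (4 * order m P0)))).
Proof.
intros h1 h2.
assert (R1 : tends_params F (fun t => reflect (P t)) (reflect P0)).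
{ destruct hP as [HA [T1 [T2 [T3 T4]]]]; repeat split; try (apply (tends_opp F); assumption).
  revert HA; apply filter_imp; intros t; apply admissible_reflect. }
assert (R2 : extremal (reflect P0)).
{ unfold extremal, reflect, p_minus, q_minus, p_plus, q_plus in *; simpl in *; lra. }
assert (K := tends_kernel_at_0 F m l _ _ hm R1 R2).
assert (Q1 : q_minus (reflect P0) = 1).
{ change (- p_minus P0 = 1); lra. }
assert (Q2 : q_plus (reflect P0) = 1).
{ change (- p_plus P0 = 1); lra. }
specialize (K Q1 Q2).
eapply (tends_ext_loc F); [|
  eapply tends_eq; [apply (tends_mult F _ _ _ _ (tends_const F (cos (IZR l * PI))) K) |]].
- generalize (proj1 hP); apply filter_imp; intros t Ht; cbv beta.
  assert (E := spectral_point_reflect m (P t) m hm Ht ltac:(lia)).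
  rewrite Z.sub_diag in E; rewrite E, kernel_reflect by exact Ht.
  (* The sign is its own inverse, which carries it to the other side of [kernel_reflect]. *)
  assert (cos (IZR l * PI) ^ 2 = 1).
  { pose proof (cos2_sin2 (IZR l * PI)) as S; rewrite sin_IZR_PI in S; lra. }
  rewrite <- Rmult_assoc; replace (cos (IZR l * PI) * cos (IZR l * PI)) with 1 by lra.
  apply Rmult_1_l.
- rewrite Delta_reflect; do 5 f_equal; unfold order, reflect, p_minus, q_minus, p_plus, q_plus; simpl; field.
Qed.

End Main.

(** * Evaluation of the limits and the common form of the sixteen cases *)

Lemma filterlim_RtoC (y : R) : filterlim RtoC (locally y) (locally (RtoC y)).
Proof.
apply (filterlim_locally (U := C_UniformSpace)); intros eps; exists eps; intros z Hz.
split; [exact Hz | apply ball_center].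
Qed.

(* Interpolates linearly in [q] between the sine ([q = 0]) and the cosine
   ([q = 1]); only these two values of [q] matter. *)
Definition phase (p q : R) (l : Z) (x : R) : R :=
  q * cos ((IZR l + (1 + p) / 2) * x) + (1 - q) * sin ((IZR l + 1 + p / 2) * x).

(** For [(p, q) = (-1, 0), (-1, 1), (0, 0), (0, 1)] the product of the two [D] is the square of
    [2 cos (x / 2)], [2 sin x], [1], [2 sin (x / 2)]. Sum-to-product or addition formulas extract
    the same factor from [numer]. *)
Lemma numer_div_sqrt_D (p q : R) (l : Z) (x : R) :
  p = -1 \/ p = 0 -> q = 0 \/ q = 1 -> 0 < x < PI ->
  numer (p * q) (p + q) l x / sqrt (D p x * D q x) = phase p q l x.
Proof.
intros Hp Hq Hx.
assert (Hs : 0 < sin (x / 2)) by (apply sin_gt_0; lra).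
assert (Hc : 0 < cos (x / 2)) by (apply cos_gt_0; lra).
assert (E2 : cos (x / 2) ^ 2 = 1 - sin (x / 2) ^ 2)
  by (pose proof (cos2_sin2 (x / 2)); lra).
assert (Ex : cos x = 1 - 2 * sin (x / 2) ^ 2)
  by (replace (cos x) with (cos (2 * (x / 2))) by (f_equal; field);
      rewrite cos_2a_sin; ring).
assert (Q : forall n d k ph, 0 < k -> d = k ^ 2 -> n = k * ph -> n / sqrt d = ph).
{ intros n d k ph Hk -> ->; rewrite sqrt_pow2 by lra; field; lra. }
assert (Sx : 0 < sin x) by (apply sin_gt_0; lra).
unfold numer, phase, D; destruct Hp as [-> | ->]; destruct Hq as [-> | ->].
- apply Q with (k := 2 * cos (x / 2)); [lra | rewrite Ex; lra |].
  transitivity (sin (IZR l * x + x) + sin (IZR l * x)); [ring |].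
  rewrite form3.
  replace ((IZR l * x + x - IZR l * x) / 2) with (x / 2) by field.
  replace ((IZR l * x + x + IZR l * x) / 2) with ((IZR l + 1 + -1 / 2) * x) by field.
  ring.
- apply Q with (k := 2 * sin x); [lra | pose proof (cos2_sin2 x); nra |].
  replace ((IZR l + (1 + -1) / 2) * x) with (IZR l * x) by field.
  rewrite sin_plus, sin_minus; ring.
- apply Q with (k := 1); [lra | ring |].
  replace ((IZR l + 1 + 0 / 2) * x) with (IZR l * x + x) by field; ring.
- apply Q with (k := 2 * sin (x / 2)); [lra | rewrite Ex; lra |].
  transitivity (sin (IZR l * x + x) - sin (IZR l * x)); [ring |].
  rewrite form4.
  replace ((IZR l * x + x - IZR l * x) / 2) with (x / 2) by field.
  replace ((IZR l * x + x + IZR l * x) / 2) with ((IZR l + (1 + 0) / 2) * x) by field.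
  ring.
Qed.

Lemma phase_q0 (p : R) (l : Z) (x : R) : phase p 0 l x = sin ((IZR l + 1 + p / 2) * x).
Proof. unfold phase; ring. Qed.

Lemma phase_q1 (p : R) (l : Z) (x : R) : phase p 1 l x = cos ((IZR l + (1 + p) / 2) * x).
Proof. unfold phase; ring. Qed.

(** This value and the one at pi let [phase] describe the endpoint limits too, up to
    normalization. *)
Lemma phase_0 (p q : R) (l : Z) : q = 1 -> phase p q l 0 = 1.
Proof. intros ->; unfold phase; rewrite Rmult_0_r, cos_0; ring. Qed.

Lemma phase_PI (p q : R) (l : Z) : p = -1 -> q = 0 \/ q = 1 ->
  phase p q l PI = cos (IZR l * PI).
Proof.
intros -> Hq; unfold phase.
replace ((IZR l + (1 + -1) / 2) * PI) with (IZR l * PI) by field.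
replace ((IZR l + 1 + -1 / 2) * PI) with (PI / 2 + IZR l * PI) by field.
rewrite <- cos_sin; destruct Hq as [-> | ->]; ring.
Qed.

Lemma sqrt_half_pow (n : nat) : sqrt ((1 / 2) ^ n) = (1 / sqrt 2) ^ n.
Proof.
replace (1 / sqrt 2) with (sqrt (1 / 2)) by (rewrite sqrt_div_alt, sqrt_1 by lra; reflexivity).
induction n as [| n IH]; simpl; [apply sqrt_1 |].
rewrite sqrt_mult_alt, IH by lra; reflexivity.
Qed.

Lemma tends_params_within (P0 : params) :
  tends_params (within admissible (locally P0)) (fun P => P) P0.
Proof.
destruct P0 as [[p1 q1] [p2 q2]].
set (U2 := prod_UniformSpace R_UniformSpace R_UniformSpace).
assert (A : forall f : params -> R, continuous f ((p1, q1), (p2, q2)) ->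
  tends (within admissible (locally ((p1, q1), (p2, q2)))) f (f ((p1, q1), (p2, q2)))).
{ intros f Hf; exact (filterlim_filter_le_1 f (filter_le_within admissible) Hf). }
repeat split.
- unfold within; apply filter_forall; trivial.
- exact (A p_minus (continuous_comp (V := U2) fst fst _ (continuous_fst (U := U2) (V := U2) _ _) (continuous_fst _ _))).
- exact (A q_minus (continuous_comp (V := U2) fst snd _ (continuous_fst (U := U2) (V := U2) _ _) (continuous_snd _ _))).
- exact (A p_plus (continuous_comp (V := U2) snd fst _ (continuous_snd (U := U2) (V := U2) _ _) (continuous_fst _ _))).
- exact (A q_plus (continuous_comp (V := U2) snd snd _ (continuous_snd (U := U2) (V := U2) _ _) (continuous_snd _ _))).
Qed.

Lemma limit_point_interior (m : Z) (P : params) (hl : Z) :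
  0 < IZR hl + 1 - (q_minus P + q_plus P) / 2 < order m P ->
  0 < limit_point m P hl < PI.
Proof.
intros Hh; pose proof PI_RGT_0; unfold limit_point; split.
- apply Rdiv_lt_0_compat; nra.
- apply Rlt_div_l; nra.
Qed.

(** With both [p = -1] only the [1 - q^2] contribute to [order], and [1 - q^2 = 1 - q] for [q] in
    {0, 1}. *)
Lemma limit_point_m (m : Z) (P : params) : (1 <= m)%Z -> extremal P ->
  p_minus P = -1 -> p_plus P = -1 -> limit_point m P m = PI.
Proof.
intros Hm HP h1 h2; assert (HM := order_pos m P Hm HP).
assert (E : IZR m + 1 - (q_minus P + q_plus P) / 2 = order m P).
{ unfold order; rewrite h1, h2.
  destruct HP as [[_ [-> | ->]] [_ [-> | ->]]]; field. }
unfold limit_point; rewrite E; field; lra.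
Qed.

(** [kh] counts the factor [1 / sqrt 2] due to the doubling of [H] when the spectral point tends to
    0 or pi, and [kl] those due to the weight [Delta]. *)
Lemma limits_extremal (m hl l : Z) (P0 : params) (kh kl : nat) (x0 y0 : R) :
  (1 <= m)%Z -> (0 <= hl <= m)%Z -> extremal P0 ->
  (0 < IZR hl + 1 - (q_minus P0 + q_plus P0) / 2 < order m P0 /\ kh = 0%nat) \/
  (hl = 0%Z /\ q_minus P0 = 1 /\ q_plus P0 = 1 /\ kh = 1%nat) \/
  (hl = m /\ p_minus P0 = -1 /\ p_plus P0 = -1 /\ kh = 1%nat) ->
  Delta m P0 l = (1 / 2) ^ kl ->
  x0 = limit_point m P0 hl ->
  y0 = sqrt (2 / order m P0) * phase (p_minus P0) (q_minus P0) l x0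
    * (1 / sqrt 2) ^ (kh + kl) ->
  limits_at m hl l P0 x0 y0.
Proof.
intros Hm Hl HP0 Hk HD -> ->.
set (F := within admissible (locally P0)).
assert (FF : Filter F) by (apply within_filter; apply locally_filter).
assert (HP := tends_params_within P0); fold F in HP.
assert (HM := order_pos m P0 Hm HP0); pose proof PI_RGT_0 as HPI.
assert (Hx : 0 <= limit_point m P0 hl <= PI).
{ destruct Hk as [[Hh _] | [[-> [h1 [h2 _]]] | [-> [h1 [h2 _]]]]].
  - apply limit_point_interior in Hh; lra.
  - rewrite limit_point_0 by trivial; lra.
  - rewrite limit_point_m by trivial; lra. }
split; [apply (tends_spectral_point F m hl (fun P => P) P0); trivial |].
apply (filterlim_ext_loc (fun P => RtoC (kernel m P l (spectral_point m P hl)))).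
{ unfold F, within; apply filter_forall; intros P HPa; symmetry.
  apply Psi_explicit; trivial. }
eapply filterlim_comp; [| apply filterlim_RtoC].
assert (HS : 0 < sqrt 2) by (apply sqrt_lt_R0; lra).
assert (R1 : sqrt (Delta m P0 l) = (1 / sqrt 2) ^ kl) by (rewrite HD; apply sqrt_half_pow).
assert (R2 : sqrt (Delta m P0 l / (2 * order m P0)) =
   (1 / sqrt 2) ^ kl * (sqrt (2 / order m P0) / 2)).
{ replace (Delta m P0 l / (2 * order m P0)) with (Delta m P0 l * (2 / order m P0 / 2 ^ 2)) by (field; lra).
  rewrite sqrt_mult_alt by (rewrite HD; apply pow_le; lra).
  rewrite sqrt_div_alt, sqrt_pow2, R1 by lra; reflexivity. }
(* Against [R2] the doubled [H] costs one further factor [1 / sqrt 2]. *)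
assert (R3 : sqrt (Delta m P0 l / (4 * order m P0)) =
   (1 / sqrt 2) ^ S kl * (sqrt (2 / order m P0) / 2)).
{ replace (Delta m P0 l / (4 * order m P0)) with (1 / 2 * (Delta m P0 l / (2 * order m P0))) by (field; lra).
  rewrite sqrt_mult_alt, R2, sqrt_div_alt, sqrt_1 by lra; simpl; ring. }
destruct Hk as [[Hh ->] | [[-> [h1 [h2 ->]]] | [-> [h1 [h2 ->]]]]].
- apply limit_point_interior in Hh.
  eapply tends_eq; [apply (tends_kernel_interior F m hl l (fun P => P) P0); trivial |].
  rewrite <- (numer_div_sqrt_D (p_minus P0) (q_minus P0) l); trivial; try apply HP0.
  rewrite R2; unfold Rdiv, a_minus; simpl; field.
  apply Rgt_not_eq, sqrt_lt_R0, Rmult_lt_0_compat; apply D_pos_extremal; trivial;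
    unfold sign_or_zero; destruct HP0 as [[? ?] _]; tauto.
- eapply tends_eq; [apply (tends_kernel_at_0 F m l (fun P => P) P0); trivial |].
  rewrite R3, limit_point_0, phase_0 by trivial; simpl; field; lra.
- eapply tends_eq; [apply (tends_kernel_at_PI F m l (fun P => P) P0); trivial |].
  rewrite R3, limit_point_m, phase_PI by (trivial; apply HP0); simpl; field; lra.
Qed.

(** Since [m >= 1], the extreme indices are distinct. The inner case is phrased over the reals so
    that linear arithmetic can place the limit inside (0, pi). *)
Lemma index_cases (m hl : Z) : (1 <= m)%Z -> (0 <= hl <= m)%Z ->
  (hl = 0%Z /\ kron hl = 1%nat /\ kron (m - hl) = 0%nat) \/
  (hl = m /\ kron hl = 0%nat /\ kron (m - hl) = 1%nat) \/
  (1 <= IZR hl /\ IZR hl + 1 <= IZR m /\ kron hl = 0%nat /\ kron (m - hl) = 0%nat).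
Proof.
intros Hm Hl; unfold kron.
destruct (Z.eqb_spec hl 0); destruct (Z.eqb_spec (m - hl) 0); try lia.
right; right; repeat split.
- apply IZR_le; lia.
- rewrite <- plus_IZR; apply IZR_le; lia.
Qed.

Ltac limits_tac Hcases a b :=
  apply limits_extremal with (kh := a) (kl := b); trivial;
  [ unfold extremal, p_minus, q_minus, p_plus, q_plus; simpl; lra
  | unfold order, p_minus, q_minus, p_plus, q_plus; simpl fst; simpl snd;
    destruct Hcases as [[-> [e1 e2]] | [[-> [e1 e2]] | [Ha [Hb [e1 e2]]]]];
    rewrite ?e1, ?e2;
    first [ left; split; [lra | reflexivity]
          | right; left; repeat split; lra
          | right; right; repeat split; lra ]
  | unfold Delta, a_minus, a_plus, p_minus, q_minus, p_plus, q_plus, kron; simpl fst; simpl snd;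
    repeat match goal with |- context [Z.eqb ?a 0] => destruct (Z.eqb_spec a 0) end;
    try lia; simpl; field
  | unfold limit_point, order, p_minus, q_minus, p_plus, q_plus; simpl fst; simpl snd; field; lra
  | ].

Ltac kernel_tac :=
  unfold order, p_minus, q_minus, p_plus, q_plus; simpl fst; simpl snd;
  rewrite ?phase_q0, ?phase_q1;
  lazymatch goal with
  | |- _ * _ * _ ^ _ = _ => apply f_equal2; [| f_equal; lia]
  (* Four of the cosine and sine families and others without boundary factors state no power at all;
     there both exponents are 0. *)
  | |- _ => change (0 + 0)%nat with 0%nat; rewrite pow_O, Rmult_1_r
  end;
  apply f_equal2; f_equal; field; lra.

Theorem mainTheorem3 (m : Z) (hm : (1 <= m)%Z) (hl l : Z)
  (hhl : (0 <= hl <= m)%Z) (hl' : (0 <= l <= m)%Z) :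
  (* DCT-1 *)
  limits_at m hl l ((-1, 1), (-1, 1))
    (PI * IZR hl / IZR m)
    (sqrt (2 / IZR m) * cos (PI * IZR hl * IZR l / IZR m)
       * (1 / sqrt 2) ^ (kron hl + kron (m - hl) + kron l + kron (m - l))) /\
  (* DCT-2 *)
  limits_at m hl l ((0, 1), (0, 1))
    (PI * IZR hl / (IZR m + 1))
    (sqrt (2 / (IZR m + 1)) * cos (PI * IZR hl * (IZR l + 1 / 2) / (IZR m + 1))
       * (1 / sqrt 2) ^ (kron hl)) /\
  (* DCT-3 *)
  limits_at m hl l ((-1, 1), (0, 0))
    (PI * (IZR hl + 1 / 2) / (IZR m + 1))
    (sqrt (2 / (IZR m + 1)) * cos (PI * (IZR hl + 1 / 2) * IZR l / (IZR m + 1))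
       * (1 / sqrt 2) ^ (kron l)) /\
  (* DCT-4 *)
  limits_at m hl l ((0, 1), (-1, 0))
    (PI * (IZR hl + 1 / 2) / (IZR m + 1))
    (sqrt (2 / (IZR m + 1)) * cos (PI * (IZR hl + 1 / 2) * (IZR l + 1 / 2) / (IZR m + 1))) /\
  (* DCT-5 *)
  limits_at m hl l ((-1, 1), (0, 1))
    (PI * IZR hl / (IZR m + 1 / 2))
    (sqrt (2 / (IZR m + 1 / 2)) * cos (PI * IZR hl * IZR l / (IZR m + 1 / 2))
       * (1 / sqrt 2) ^ (kron l + kron hl)) /\
  (* DCT-6 *)
  limits_at m hl l ((0, 1), (-1, 1))
    (PI * IZR hl / (IZR m + 1 / 2))
    (sqrt (2 / (IZR m + 1 / 2)) * cos (PI * IZR hl * (IZR l + 1 / 2) / (IZR m + 1 / 2))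
       * (1 / sqrt 2) ^ (kron hl + kron (m - l))) /\
  (* DCT-7 *)
  limits_at m hl l ((-1, 1), (-1, 0))
    (PI * (IZR hl + 1 / 2) / (IZR m + 1 / 2))
    (sqrt (2 / (IZR m + 1 / 2)) * cos (PI * (IZR hl + 1 / 2) * IZR l / (IZR m + 1 / 2))
       * (1 / sqrt 2) ^ (kron (m - hl) + kron l)) /\
  (* DCT-8 *)
  limits_at m hl l ((0, 1), (0, 0))
    (PI * (IZR hl + 1 / 2) / (IZR m + 3 / 2))
    (sqrt (2 / (IZR m + 3 / 2)) * cos (PI * (IZR hl + 1 / 2) * (IZR l + 1 / 2) / (IZR m + 3 / 2))) /\
  (* DST-1 *)
  limits_at m hl l ((0, 0), (0, 0))
    (PI * (IZR hl + 1) / (IZR m + 2))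
    (sqrt (2 / (IZR m + 2)) * sin (PI * (IZR hl + 1) * (IZR l + 1) / (IZR m + 2))) /\
  (* DST-2 *)
  limits_at m hl l ((-1, 0), (-1, 0))
    (PI * (IZR hl + 1) / (IZR m + 1))
    (sqrt (2 / (IZR m + 1)) * sin (PI * (IZR hl + 1) * (IZR l + 1 / 2) / (IZR m + 1))
       * (1 / sqrt 2) ^ (kron (m - hl))) /\
  (* DST-3 *)
  limits_at m hl l ((0, 0), (-1, 1))
    (PI * (IZR hl + 1 / 2) / (IZR m + 1))
    (sqrt (2 / (IZR m + 1)) * sin (PI * (IZR hl + 1 / 2) * (IZR l + 1) / (IZR m + 1))
       * (1 / sqrt 2) ^ (kron (m - l))) /\
  (* DST-4 *)
  limits_at m hl l ((-1, 0), (0, 1))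
    (PI * (IZR hl + 1 / 2) / (IZR m + 1))
    (sqrt (2 / (IZR m + 1)) * sin (PI * (IZR hl + 1 / 2) * (IZR l + 1 / 2) / (IZR m + 1))) /\
  (* DST-5 *)
  limits_at m hl l ((0, 0), (-1, 0))
    (PI * (IZR hl + 1) / (IZR m + 3 / 2))
    (sqrt (2 / (IZR m + 3 / 2)) * sin (PI * (IZR hl + 1) * (IZR l + 1) / (IZR m + 3 / 2))) /\
  (* DST-6 *)
  limits_at m hl l ((-1, 0), (0, 0))
    (PI * (IZR hl + 1) / (IZR m + 3 / 2))
    (sqrt (2 / (IZR m + 3 / 2)) * sin (PI * (IZR hl + 1) * (IZR l + 1 / 2) / (IZR m + 3 / 2))) /\
  (* DST-7 *)
  limits_at m hl l ((0, 0), (0, 1))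
    (PI * (IZR hl + 1 / 2) / (IZR m + 3 / 2))
    (sqrt (2 / (IZR m + 3 / 2)) * sin (PI * (IZR hl + 1 / 2) * (IZR l + 1) / (IZR m + 3 / 2))) /\
  (* DST-8 *)
  limits_at m hl l ((-1, 0), (-1, 1))
    (PI * (IZR hl + 1 / 2) / (IZR m + 1 / 2))
    (sqrt (2 / (IZR m + 1 / 2)) * sin (PI * (IZR hl + 1 / 2) * (IZR l + 1 / 2) / (IZR m + 1 / 2))
       * (1 / sqrt 2) ^ (kron (m - hl) + kron (m - l))).
Proof.
assert (Hm : 1 <= IZR m) by (apply IZR_le; exact hm).
assert (Hcases := index_cases m hl hm hhl).
repeat match goal with |- _ /\ _ => split end.
(* In all cases [kron hl] enters when both [q = 1], [kron (m - hl)] when both [p = -1], [kron l]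
   when [p_- q_- = -1], and [kron (m - l)] when [p_+ q_+ = -1]. *)
- limits_tac Hcases (kron hl + kron (m - hl))%nat (kron l + kron (m - l))%nat.
kernel_tac.
- limits_tac Hcases (kron hl) 0%nat. kernel_tac.
- limits_tac Hcases 0%nat (kron l). kernel_tac.
- limits_tac Hcases 0%nat 0%nat. kernel_tac.
- limits_tac Hcases (kron hl) (kron l). kernel_tac.
- limits_tac Hcases (kron hl) (kron (m - l)). kernel_tac.
- limits_tac Hcases (kron (m - hl)) (kron l). kernel_tac.
- limits_tac Hcases 0%nat 0%nat. kernel_tac.
- limits_tac Hcases 0%nat 0%nat. kernel_tac.
- limits_tac Hcases (kron (m - hl)) 0%nat. kernel_tac.
- limits_tac Hcases 0%nat (kron (m - l)). kernel_tac.
- limits_tac Hcases 0%nat 0%nat. kernel_tac.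
- limits_tac Hcases 0%nat 0%nat. kernel_tac.
- limits_tac Hcases 0%nat 0%nat. kernel_tac.
- limits_tac Hcases 0%nat 0%nat. kernel_tac.
- limits_tac Hcases (kron (m - hl)) (kron (m - l)). kernel_tac.
Qed.
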